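(* Let $\mathcal{F}$ be a feasible $f$-triangle of size $d \in \mathbb{N} \cup \{\infty\}$ and assume the following for some $n \in \{1,2,\dots,d\}$: (i) $h_{\mathcal{F}}(\sigma_m, x)$ is a real-rooted polynomial for all $2 \le m < n$. (ii) $h_{\mathcal{F}}(\sigma_m, x) - h_{\mathcal{F}}(\partial\sigma_m, x)$ is either identically zero, or a real-rooted polynomial of degree $m-1$ with nonnegative coefficients which is interlaced by $h_{\mathcal{F}}(\sigma_{m-1}, x)$, for all $2 \le m \le n$. Then: (a) The polynomial $\mathcal{D}_{\mathcal{F},n}(h(x))$ is real-rooted for every polynomial $h(x) \in \mathbb{R}_n[x]$ with nonnegative coefficients. In particular, $h_{\mathcal{F}}(\Delta, x)$ is real-rooted for every $(n-1)$-dimensional simplicial complex $\Delta$ with nonnegative $h$-vector. (b) The polynomials $h_{\mathcal{F}}(\sigma_n, x)$ and $h_{\mathcal{F}}(\partial\sigma_n, x)$ are real-rooted and are interlaced by $h_{\mathcal{F}}(\sigma_{n-1}, x)$. Moreover, $h_{\mathcal{F}}(\sigma_n, x)$ has a nonnegative, real-rooted and interlacing symmetric decomposition with respect to $n-1$.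
   Context: Conventions: $\mathbb{N} = \{0,1,2,\dots\}$; if $d=\infty$ then $\{1,\dots,d\}$ means all positive integers; $n$ is finite. $\mathbb{R}_n[x]$ is the space of real polynomials of degree at most $n$; $\binom{a}{b}:=0$ unless $0\le b\le a$. All simplicial complexes are finite abstract simplicial complexes (containing the empty face, of dimension $-1$). For an $(n-1)$-dimensional simplicial complex $\Delta$, let $f_{i}(\Delta)$ be the number of $i$-dimensional faces, $f(\Delta,x) = \sum_{i=0}^n f_{i-1}(\Delta)x^i$, and $h(\Delta,x) = (1-x)^n f(\Delta, \frac{x}{1-x}) =: \sum_{i=0}^n h_i(\Delta)x^i$; the $h$-vector is $(h_0(\Delta),\dots,h_n(\Delta))$. A simplicial complex $\Delta'$ is a triangulation of $\Delta$ if there are geometric realizations $K'$ and $K$ of $\Delta'$ and $\Delta$ such that $K'$ geometrically subdivides $K$. For $F \in \Delta$, the restriction $\Delta'_F$ is the subcomplex of $\Delta'$ corresponding to the triangulation which $K'$ induces on the simplex of $K$ corresponding to $F$. An $f$-triangle of size $d$ is a triangular array $\mathcal{F} = (f_{\mathcal{F}}(i,j))_{0 \le i \le j \le d}$ of nonnegative integers. Given a simplicial complex $\Delta$ of dimension less than $d$, a triangulation $\Delta'$ of $\Delta$ is $\mathcal{F}$-uniform if for all $0 \le i \le j \le d$, the restriction of $\Delta'$ to any $(j-1)$-dimensional face of $\Delta$ has exactly $f_{\mathcal{F}}(i,j)$ faces of dimension $i-1$. Let $\sigma_n$ be the $(n-1)$-dimensional simplex (the complex of all its faces) and $\partial\sigma_n$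 its boundary complex (of dimension $n-2$). $\mathcal{F}$ is feasible if $\mathcal{F}$-uniform triangulations of $\sigma_n$ exist for all finite $n \le d$. Put $f_{\mathcal{F}}(\sigma_n,x) = \sum_{i=0}^n f_{\mathcal{F}}(i,n)x^i$, $h_{\mathcal{F}}(\sigma_n,x) = (1-x)^n f_{\mathcal{F}}(\sigma_n,\frac{x}{1-x})$ (the $h$-polynomial of any $\mathcal{F}$-uniform triangulation of $\sigma_n$), $\ell_{\mathcal{F}}(\sigma_n,x) = \sum_{k=0}^n (-1)^{n-k}\binom{n}{k} h_{\mathcal{F}}(\sigma_k,x)$, and for $0\le k\le n\le d$ $$p_{\mathcal{F},n,k}(x) = \sum_{r=0}^n \ell_{\mathcal{F}}(\sigma_r,x) \sum_{i=0}^r \binom{n-k}{i}\binom{k}{r-i} x^{k-r+i}.$$ The linear operator $\mathcal{D}_{\mathcal{F},n}:\mathbb{R}_n[x]\to\mathbb{R}_n[x]$ is defined by $\mathcal{D}_{\mathcal{F},n}(x^k) = p_{\mathcal{F},n,k}(x)$ for $0\le k\le n$. For an $(n-1)$-dimensional simplicial complex $\Delta$, $h_{\mathcal{F}}(\Delta,x) := \sum_{k=0}^n h_k(\Delta)p_{\mathcal{F},n,k}(x)$; this is the $h$-polynomial of any $\mathcal{F}$-uniform triangulation of $\Delta$. In particular, $h_{\mathcal{F}}(\partial\sigma_n,x)$ is the $h$-polynomial of any $\mathcal{F}$-uniform triangulation of $\partial\sigma_n$. A polynomial in $\mathbb{R}[x]$ is real-rooted if all its complex roots are real or it is the zero polynomial.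 A real-rooted polynomial with roots $\alpha_1 \ge \alpha_2 \ge \cdots$ (with multiplicity) interlaces a real-rooted polynomial with roots $\beta_1 \ge \beta_2 \ge \cdots$ if $\cdots \le \alpha_2 \le \beta_2 \le \alpha_1 \le \beta_1$ (so the degree of the second equals that of the first or exceeds it by one). By convention, the zero polynomial interlaces and is interlaced by every real-rooted polynomial, and constant polynomials interlace all polynomials of degree at most one. Every $g(x)\in\mathbb{R}_N[x]$ can be written uniquely as $g(x)=a(x)+xb(x)$ with $a(x)\in\mathbb{R}_N[x]$, $x^Na(1/x)=a(x)$, and $b(x)\in\mathbb{R}_{N-1}[x]$, $x^{N-1}b(1/x)=b(x)$ ($b=0$ if $N=0$). One says that $g$ has a nonnegative, real-rooted symmetric decomposition with respect to $N$ if $a$ and $b$ are real-rooted with nonnegative coefficients; such a decomposition is interlacing if $b(x)$ interlaces $a(x)$ (equivalently, $a$ interlaces $g$; equivalently, $b$ interlaces $g$; equivalently, $x^Ng(1/x)$ interlaces $g(x)$). *)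

(* Defs.v *)
From HB Require Import structures.
From mathcomp Require Import all_boot all_order all_algebra.
From mathcomp Require Import boolp reals.
From mathcomp Require Import complex.

Set Implicit Arguments.
Unset Strict Implicit.
Unset Printing Implicit Defensive.

Import Order.TTheory GRing.Theory Num.Theory.
Local Open Scope ring_scope.

Section SimplicialComplexes.
Variable V : finType.
Implicit Types (Delta : {set {set V}}) (F G : {set V}).

(* An element v of V is a vertex of Delta only if [set v] \in Delta. *)
Definition simplicial_complex Delta : Prop :=
  set0 \in Delta /\ forall F G, F \in Delta -> G \subset F -> G \in Delta.

(* The dimension of Delta plus one. *)
Definition rank_complex Delta : nat := \max_(F in Delta) #|F|.

(* f_{i-1}(Delta), the number of faces with i vertices. *)
Definition nfaces Delta (i : nat) : nat := #|[set F in Delta | #|F| == i]|.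

End SimplicialComplexes.

Definition simplex (n : nat) : {set {set 'I_n}} := [set: {set 'I_n}].
Definition simplex_boundary (n : nat) : {set {set 'I_n}} := [set~ [set: 'I_n]].

Section Geometry.
Variables (R : realType) (N : nat).

Section Realization.
Variable V : finType.
Implicit Types (Delta : {set {set V}}) (F G : {set V}) (p : V -> 'rV[R]_N).

Definition affinely_independent p F : Prop :=
  forall w : V -> R, \sum_(v in F) w v = 0 -> \sum_(v in F) w v *: p v = 0 ->
    forall v, v \in F -> w v = 0.

(* x lies in the convex hull of the points p v, v \in F; false if F is empty. *)
Definition in_hull p F (x : 'rV[R]_N) : Prop :=
  exists w : V -> R, [/\ forall v, v \in F -> 0 <= w v,
    \sum_(v in F) w v = 1 & x = \sum_(v in F) w v *: p v].

(* The simplices spanned by the points p v, v \in F, for F in Delta form a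
   geometric simplicial complex whose face poset is that of Delta.  For
   one-element F and G the second condition says that p is injective on the
   vertices of Delta. *)
Definition geometric_realization Delta p : Prop :=
  (forall F, F \in Delta -> affinely_independent p F) /\
  (forall F G, F \in Delta -> G \in Delta ->
     forall x, in_hull p F x /\ in_hull p G x <-> in_hull p (F :&: G) x).

Definition in_polyhedron Delta p (x : 'rV[R]_N) : Prop :=
  exists2 F, F \in Delta & in_hull p F x.

End Realization.

Definition geometrically_subdivides (V V' : finType)
    (Delta' : {set {set V'}}) (p' : V' -> 'rV[R]_N)
    (Delta : {set {set V}}) (p : V -> 'rV[R]_N) : Prop :=
  (forall G, G \in Delta' -> exists2 F, F \in Delta &
     forall x, in_hull p' G x -> in_hull p F x) /\
  (forall x, in_polyhedron Delta' p' x <-> in_polyhedron Delta p x).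

End Geometry.

(* The realizations are part of the data, since restrictions to the faces of
   Delta depend on them. *)
Record triangulation (R : realType) (V V' : finType)
    (Delta : {set {set V}}) (Delta' : {set {set V'}}) := Triangulation {
  ambient : nat;
  pt : V -> 'rV[R]_ambient;
  pt' : V' -> 'rV[R]_ambient;
  triangulation_complex : simplicial_complex Delta';
  triangulation_pt : geometric_realization Delta pt;
  triangulation_pt' : geometric_realization Delta' pt';
  triangulation_subdivides : geometrically_subdivides Delta' pt' Delta pt
}.

Section Uniform.
Variables (R : realType) (V V' : finType).
Variables (Delta : {set {set V}}) (Delta' : {set {set V'}}).

Definition restriction (T : triangulation R Delta Delta') (F : {set V}) :
    {set {set V'}} :=
  [set G in Delta' | `[< forall x, in_hull (pt' T) G x -> in_hull (pt T) F x >]].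

End Uniform.

(* Sizes d in N \cup {oo}; None is oo. *)
Definition le_size (n : nat) (d : option nat) : bool :=
  if d is Some m then (n <= m)%N else true.

(* An f-triangle of size d is given by a function f : nat -> nat -> nat, whose
   values f i j outside the range i <= j <= d are irrelevant. *)
Definition uniform (R : realType) (d : option nat) (f : nat -> nat -> nat)
    (V V' : finType) (Delta : {set {set V}}) (Delta' : {set {set V'}})
    (T : triangulation R Delta Delta') : Prop :=
  forall i j, (i <= j)%N -> le_size j d ->
    forall F, F \in Delta -> #|F| = j -> nfaces (restriction T F) i = f i j.

Definition feasible (R : realType) (d : option nat) (f : nat -> nat -> nat) :
    Prop :=
  forall n, le_size n d ->
    exists (V' : finType) (Delta' : {set {set V'}})
           (T : triangulation R (simplex n) Delta'), uniform d f T.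

Section Polynomials.
Variable R : realType.
Implicit Types (p q g a b h : {poly R}) (f : nat -> nat -> nat).

Definition nonneg_coefs p : Prop := forall i, 0 <= p`_i.

(* (1 - x)^n p(x / (1 - x)), for p of degree at most n. *)
Definition f_to_h (n : nat) p : {poly R} :=
  \sum_(i < n.+1) p`_i *: ('X^i * (1 - 'X) ^+ (n - i)).

Definition fpoly (V : finType) (Delta : {set {set V}}) : {poly R} :=
  \sum_(i < (rank_complex Delta).+1) (nfaces Delta i)%:R *: 'X^i.

Definition hpoly (V : finType) (Delta : {set {set V}}) : {poly R} :=
  f_to_h (rank_complex Delta) (fpoly Delta).

Definition fpoly_simplex f (n : nat) : {poly R} :=
  \sum_(i < n.+1) (f i n)%:R *: 'X^i.

Definition hpoly_simplex f (n : nat) : {poly R} := f_to_h n (fpoly_simplex f n).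

Definition ellpoly f (n : nat) : {poly R} :=
  \sum_(k < n.+1) (-1) ^+ (n - k) * 'C(n, k)%:R * hpoly_simplex f k.

(* The exponent is (k - r) + i in Z; it is nonnegative, hence equal to the
   truncated difference below, whenever 'C(k, r - i) is nonzero. *)
Definition ppoly f (n k : nat) : {poly R} :=
  \sum_(r < n.+1) ellpoly f r *
    \sum_(i < r.+1) ('C(n - k, i) * 'C(k, r - i))%:R *: 'X^(k + i - r).

(* Only meant for h of degree at most n. *)
Definition Dop f (n : nat) h : {poly R} := \sum_(k < n.+1) h`_k *: ppoly f n k.

Definition hpoly_uniform f (V : finType) (Delta : {set {set V}}) : {poly R} :=
  \sum_(k < (rank_complex Delta).+1)
    (hpoly Delta)`_k *: ppoly f (rank_complex Delta) k.

Definition real_rooted p : Prop :=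
  p = 0 \/
  forall z : R[i], root (map_poly (real_complex R) p) z -> z \is Num.real.

(* s lists the roots of p with multiplicity, in weakly decreasing order. *)
Definition root_seq p (s : seq R) : Prop :=
  sorted >=%R s /\ p = lead_coef p *: \prod_(a <- s) ('X - a%:P).

(* p interlaces q. *)
Definition interlaces p q : Prop :=
  [/\ real_rooted p, real_rooted q &
      p = 0 \/ q = 0 \/
      exists s t : seq R,
        [/\ root_seq p s, root_seq q t,
            size t = size s \/ size t = (size s).+1,
            forall i, (i < size s)%N -> s`_i <= t`_i &
            forall i, (i.+1 < size t)%N -> t`_i.+1 <= s`_i]].

(* x^n p(1/x), for p of degree at most n. *)
Definition reversal (n : nat) p : {poly R} := \poly_(i < n.+1) p`_(n - i).

(* The second size bound forces b = 0 when N = 0. *)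
Definition symmetric_decomposition (N : nat) g a b : Prop :=
  [/\ g = a + 'X * b,
      (size a <= N.+1)%N, reversal N a = a,
      (size b <= N)%N & reversal N.-1 b = b].

Definition nonneg_rr_interlacing_symdec (N : nat) g : Prop :=
  exists a b,
    [/\ symmetric_decomposition N g a b,
        real_rooted a /\ real_rooted b,
        nonneg_coefs a /\ nonneg_coefs b & interlaces b a].

End Polynomials.

(* Main.v *)
Require Import Defs.
From mathcomp Require Import all_boot all_order all_algebra.
From mathcomp Require Import reals.
From mathcomp Require Import boolp complex ring lra zify.

(** Let p_{m,k} be the polynomials attached to the f-triangle, h_m = p_{m,0}
    that of the simplex, and q_m the difference of h_m and the polynomial of the
    boundary.  The theorem follows once p_{n,0}, ..., p_{n,n} is known to be an
    interlacing sequence: these polynomials are real-rooted with nonnegative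
    coefficients and p_{n,i} interlaces p_{n,j} whenever i <= j.  Indeed every
    nonnegative combination of them is then interlaced by p_{n,0}.

    This is proved by induction on n.  The recurrence
    p_{m+1,k+1} = p_{m+1,k} + (x - 1) p_{m,k} (lemma [ppoly_rec]) unfolds to
      p_{m+1,k} = x (sum of p_{m,i}, i < k) + (sum of p_{m,i}, i >= k) + q_{m+1},
    and the right-hand side defines an interlacing sequence in k as soon as the
    p_{m,i} do and each of them interlaces q_{m+1} ([interlacing_next_row]).
    The hypothesis provides the latter for i = 0.  Since q_{m+1} is palindromic
    and p_{m,m} is the reversal of p_{m,0}, it follows for i = m, and then for
    the other i because their roots lie between those of p_{m,0} and p_{m,m}
    ([interior_partP]).  The boundary polynomial is the sum of the p_{m,i}; as
    it is palindromic too, it is the symmetric part of h_{m+1}, and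
    q_{m+1} / x is the other part of the decomposition.

    Interlacing is not convenient for sums of polynomials.  For real-rooted
    f and g with positive leading coefficients, f interlaces g if and only if
    (g(x) f(y) - f(x) g(y)) / (x - y) is a sum of kernels u(x) u(y), a condition
    additive in f and in g.  One direction is an induction peeling off the
    largest roots ([count_interlace_bezout_cert]); the other looks at the signs
    of the Wronskian at the roots ([bezout_pos_count_interlace]).  The condition
    also shows directly that g is real-rooted if f is
    ([bezout_pos_real_rooted]).

    The symmetries hold because the f-triangle comes from geometric
    triangulations of simplices.  In barycentric coordinates such a
    triangulation spans a simplicial fan that fills the nonnegative orthant
    ([triangulation_fan]).  The alternating sum over the faces that contain a
    given face is then computed by moving from every cone in a generic
    direction and noting which full-dimensional cone is entered ([fan_euler]).
    Inclusion and exclusion over the faces of the simplex turns this Euler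
    relation into the statement that p_{m,m} is the reversal of h_m
    ([hpoly_simplex_dehn_sommerville]). *)

Set Implicit Arguments.
Unset Strict Implicit.
Unset Printing Implicit Defensive.

Import Order.TTheory GRing.Theory Num.Theory.
Local Open Scope ring_scope.

(** * Bezout certificates *)

Lemma poly_natroots0 (F : numDomainType) (N : nat) (p : {poly F}) :
  (forall n : nat, (N <= n)%N -> p.[n%:R] = 0) -> p = 0.
Proof.
move=> p0; apply/eqP; apply: contraT => pN0.
have := @max_poly_roots _ p [seq i%:R | i <- iota N (size p)] pN0.
rewrite size_map size_iota ltnn => -> //.
- apply/allP=> _ /mapP[i + ->]; rewrite mem_iota => /andP[Ni _].
  by rewrite /root p0.
- rewrite map_inj_uniq ?iota_uniq // => i j /eqP.
  by rewrite eqr_nat => /eqP.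
Qed.

(** The polynomials us exhibit the Bezoutian
    (g(x) f(y) - f(x) g(y)) / (x - y) as a sum of kernels u(x) u(y).  When f and
    g are real-rooted with positive leading coefficients, such us exist exactly
    when f interlaces g; unlike interlacing of roots, the condition is visibly
    additive in f and in g. *)
Definition bezout_cert (F : numDomainType) (us : seq {poly F})
  (f g : {poly F}) :=
  forall x y, g.[x] * f.[y] - f.[x] * g.[y] =
    (x - y) * \sum_(u <- us) u.[x] * u.[y].

(** Both sides are polynomials in x for fixed y and in y for fixed x, so that
    checking large integers suffices.  This is how the identity is moved to a
    larger field, and how factors that vanish at finitely many points are
    cancelled. *)
Lemma bezout_cert_nat (F : numDomainType) (us : seq {poly F})
  (f g : {poly F}) (N : nat) :
  (forall i j : nat, (N <= i)%N -> (N <= j)%N ->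
    g.[i%:R] * f.[j%:R] - f.[i%:R] * g.[j%:R] =
    (i%:R - j%:R) * \sum_(u <- us) u.[i%:R] * u.[j%:R]) ->
  bezout_cert us f g.
Proof.
move=> H x y.
have H1 (j : nat) : (N <= j)%N ->
  forall z, g.[z] * f.[j%:R] - f.[z] * g.[j%:R] =
    (z - j%:R) * \sum_(u <- us) u.[z] * u.[j%:R].
  move=> Nj z; apply/eqP; rewrite -subr_eq0; apply/eqP.
  pose p := f.[j%:R] *: g - g.[j%:R] *: f -
    ('X - (j%:R)%:P) * \sum_(u <- us) u.[j%:R] *: u.
  have pE w : p.[w] = g.[w] * f.[j%:R] - f.[w] * g.[j%:R] -
      (w - j%:R) * \sum_(u <- us) u.[w] * u.[j%:R].
    rewrite /p !(hornerD, hornerN, hornerM, hornerZ, hornerC, hornerX, horner_sum).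
    rewrite mulrC [g.[_] * f.[w]]mulrC; congr (_ - _ * _).
    by apply: eq_bigr => u _; rewrite hornerZ mulrC.
  by rewrite -pE (@poly_natroots0 _ N p) ?horner0 // => i Ni;
    rewrite pE H // subrr.
apply/eqP; rewrite -subr_eq0; apply/eqP.
pose p := g.[x] *: f - f.[x] *: g -
    (x%:P - 'X) * \sum_(u <- us) u.[x] *: u.
have pE w : p.[w] = g.[x] * f.[w] - f.[x] * g.[w] -
    (x - w) * \sum_(u <- us) u.[x] * u.[w].
  rewrite /p !(hornerD, hornerN, hornerM, hornerZ, hornerC, hornerX, horner_sum).
  by congr (_ - _ * _); apply: eq_bigr => u _; rewrite hornerZ.
by rewrite -pE (@poly_natroots0 _ N p) ?horner0 // => i Ni;
  rewrite pE H1 // subrr.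
Qed.

Lemma bezout_cert_map (F K : numDomainType)
  (phi : {rmorphism F -> K}) us (f g : {poly F}) :
  bezout_cert us f g ->
  bezout_cert (map (map_poly phi) us) (map_poly phi f) (map_poly phi g).
Proof.
move=> H; apply: (@bezout_cert_nat _ _ _ _ 0) => i j _ _.
rewrite big_map -!(rmorph_nat phi) !horner_map -!rmorphM -!rmorphB H rmorphM rmorph_sum.
congr (_ * _); rewrite ?rmorph_sum; apply: eq_bigr => u _.
by rewrite !horner_map rmorphM.
Qed.

(** * Interlacing of root sequences in terms of root counts *)

Section RootCounts.
Variable R : realType.
Implicit Types (s t : seq R) (x a : R).

Definition count_above s x : nat := count (fun a => x < a) s.
Arguments count_above : simpl never.

(** The counts do not see the order in which the roots are listed, and they
    turn removal of a common root and comparison of several root sequences into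
    linear arithmetic. *)
Definition count_interlace s t :=
  forall x, (count_above s x <= count_above t x <= (count_above s x).+1)%N.

Lemma count_above_perm {s t} : perm_eq s t -> count_above s =1 count_above t.
Proof. by move=> st x; apply: (permP st). Qed.

Lemma count_interlace_perm {s s' t t'} : perm_eq s s' -> perm_eq t t' ->
  count_interlace s t -> count_interlace s' t'.
Proof.
move=> ss tt st x; move: (st x).
by rewrite (count_above_perm ss) (count_above_perm tt).
Qed.

Lemma count_above0 s x : all (fun a => a <= x) s -> count_above s x = 0%N.
Proof.
move=> /allP sx; apply/eqP; rewrite -leqn0 leqNgt -has_count.
by apply/hasPn => a /sx; rewrite -leNgt.
Qed.

Lemma count_above_cons a s x : count_above (a :: s) x =
  ((x < a)%R + count_above s x)%N.
Proof. by []. Qed.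

(** Below a the new root a adds one to the count, and from a on all counts
    vanish. *)
Lemma flip_count_interlace a s t :
  all (fun b => b <= a) s -> all (fun b => b <= a) t ->
  (count_interlace s (a :: t) <-> count_interlace t s).
Proof.
move=> sa ta; split=> H x; move: (H x); rewrite count_above_cons;
  case: (ltP x a) => [_|ax];
  try by lia.
all: rewrite ![count_above _ x]count_above0 //;
  apply: sub_all sa || apply: sub_all ta.
all: by move=> b /le_trans; apply.
Qed.

Lemma sorted_head_max a s : sorted >=%R (a :: s) -> all (fun b => b <= a) s.
Proof. by rewrite /= path_sortedE; [case/andP | exact: rev_trans le_trans]. Qed.

Lemma sorted_count_above s x i : sorted >=%R s -> (i < size s)%N ->
  (x < s`_i) = (i < count_above s x)%N.
Proof.
elim: s i => [|a s IHs] [|i] //= ss; rewrite count_above_cons.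
- move=> _; case: (ltP x a) => [_|ax]; first by rewrite add1n.
  rewrite count_above0 //.
  by apply: sub_all (sorted_head_max ss) => b /le_trans; apply.
- rewrite ltnS => ilt; rewrite IHs ?(path_sorted ss) //.
  case: (ltP x a) => [_|ax]; first by rewrite add1n ltnS.
  rewrite count_above0 ?addn0 ?ltn0 //.
  by apply: sub_all (sorted_head_max ss) => b /le_trans; apply.
Qed.

Lemma count_above_size s x : (count_above s x <= size s)%N.
Proof. exact: count_size. Qed.

Lemma count_above_total s t :
  exists x, count_above s x = size s /\ count_above t x = size t.
Proof.
pose x := \big[Num.min/0]_(a <- s ++ t) a - 1.
have xP r : {subset r <= s ++ t} -> count_above r x = size r.
  move=> sub; apply/eqP; rewrite -all_count; apply/allP => a /sub ast.
  suff : \big[Num.min/0]_(a <- s ++ t) a <= a by rewrite /x; lra.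
  elim: (s ++ t) ast => //= b r' IHr; rewrite inE big_cons ge_min.
  by case: eqP => [->|_ /= /IHr ->]; rewrite ?lexx ?orbT.
by exists x; split; apply: xP => a; rewrite mem_cat => ->; rewrite ?orbT.
Qed.

(** In a sorted s the entry s_i exceeds x exactly when more than i entries
    do, so that evaluating the counts at the entries themselves recovers the
    alternation. *)
Lemma count_interlaceP s t : sorted >=%R s -> sorted >=%R t ->
  count_interlace s t <->
  [/\ size t = size s \/ size t = (size s).+1,
      forall i, (i < size s)%N -> s`_i <= t`_i &
      forall i, (i.+1 < size t)%N -> t`_i.+1 <= s`_i].
Proof.
move=> ss st; split=> [H|[sz H1 H2] x].
  have [x [sx tx]] := count_above_total s t.
  have := H x; rewrite sx tx => szs; split; first by lia.
  - move=> i ilt; rewrite leNgt; apply/negP => lt1.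
    have := H (t`_i); move: (ltxx t`_i) lt1.
    by rewrite !sorted_count_above //; lia.
  - move=> i ilt; rewrite leNgt; apply/negP => lt1.
    have := H (s`_i); move: (ltxx s`_i) lt1.
    rewrite !sorted_count_above //; last lia.
    by lia.
apply/andP; split; rewrite leqNgt; apply/negP => lt1.
- have lts : (count_above t x < size s)%N
  by apply: leq_trans lt1 (count_above_size _ _).
  have ltt : (count_above t x < size t)%N by lia.
  have := lt_le_trans _ (H1 _ lts) => /(_ x).
  by rewrite (sorted_count_above _ ss lts) lt1 => /(_ isT);
    rewrite (sorted_count_above _ st) // ltnn.
- have ltt : ((count_above s x).+1 < size t)%N
  by apply: leq_trans lt1 (count_above_size _ _).
  have lts : (count_above s x < size s)%N by lia.
  have := lt_le_trans _ (H2 _ ltt) => /(_ x).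
  by rewrite (sorted_count_above _ st ltt) lt1 => /(_ isT);
    rewrite (sorted_count_above _ ss) // ltnn.
Qed.

End RootCounts.

(** * Bezoutians that are sums of squares *)

Section Bezout.
Variable R : realType.
Implicit Types (s t : seq R) (f g u p : {poly R}) (us : seq {poly R}) (x y : R).

Definition bezout_pos f g := exists us, bezout_cert us f g.

Lemma bezout_pos_add_l f1 f2 g : bezout_pos f1 g -> bezout_pos f2 g ->
  bezout_pos (f1 + f2) g.
Proof.
move=> [us Hu] [vs Hv]; exists (us ++ vs) => x y.
by rewrite big_cat /= mulrDr -Hu -Hv !hornerD; ring.
Qed.

Lemma bezout_pos_add_r f g1 g2 : bezout_pos f g1 -> bezout_pos f g2 ->
  bezout_pos f (g1 + g2).
Proof.
move=> [us Hu] [vs Hv]; exists (us ++ vs) => x y.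
by rewrite big_cat /= mulrDr -Hu -Hv !hornerD; ring.
Qed.

Lemma bezout_pos_0l g : bezout_pos 0 g.
Proof. by exists [::] => x y; rewrite big_nil !horner0; ring. Qed.

Lemma bezout_pos_0r f : bezout_pos f 0.
Proof. by exists [::] => x y; rewrite big_nil !horner0; ring. Qed.

Lemma bezout_pos_refl f : bezout_pos f f.
Proof. by exists [::] => x y; rewrite big_nil; ring. Qed.

Lemma bezout_pos_sum_l (I : Type) (r : seq I) (P : pred I)
  (F : I -> {poly R}) g :
  (forall i, P i -> bezout_pos (F i) g) ->
    bezout_pos (\sum_(i <- r | P i) F i) g.
Proof.
by move=> H; elim/big_rec: _ => [|i p Pi];
  [exact: bezout_pos_0l | apply/bezout_pos_add_l/H].
Qed.

Lemma bezout_pos_sum_r (I : Type) (r : seq I) (P : pred I)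
  (F : I -> {poly R}) f :
  (forall i, P i -> bezout_pos f (F i)) ->
    bezout_pos f (\sum_(i <- r | P i) F i).
Proof.
by move=> H; elim/big_rec: _ => [|i p Pi];
  [exact: bezout_pos_0r | apply/bezout_pos_add_r/H].
Qed.

Lemma bezout_cert_scale us f g (c : R) : 0 <= c -> bezout_cert us f g ->
  bezout_cert [seq Num.sqrt c *: u | u <- us] f (c *: g).
Proof.
move=> c0 H x y; rewrite big_map !hornerZ.
have -> : c * g.[x] * f.[y] - f.[x] * (c * g.[y]) =
  c * (g.[x] * f.[y] - f.[x] * g.[y]) by ring.
rewrite H mulrCA; congr (_ * _); rewrite mulr_sumr; apply: eq_bigr => u _.
by rewrite !hornerZ -{1}(sqr_sqrtr c0); ring.
Qed.

Lemma bezout_pos_scale_r f g (c : R) : 0 <= c -> bezout_pos f g ->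
  bezout_pos f (c *: g).
Proof. by move=> c0 [us H]; exists [seq Num.sqrt c *: u | u <- us];
  apply: bezout_cert_scale. Qed.

(** The Bezoutian is antisymmetric in its two arguments. *)
Lemma bezout_pos_swapN f g : bezout_pos f g <-> bezout_pos g (- f).
Proof.
by split=> [] [us H]; exists us => x y; rewrite -H !hornerN; ring.
Qed.

Lemma bezout_pos_scale_l f g (c : R) : 0 <= c -> bezout_pos f g ->
  bezout_pos (c *: f) g.
Proof.
move=> c0 /bezout_pos_swapN /(bezout_pos_scale_r c0) H; apply/bezout_pos_swapN.
by rewrite -scalerN.
Qed.

Lemma bezout_pos_mulX2 f g : bezout_pos f g -> bezout_pos ('X * f) ('X * g).
Proof.
move=> [us H]; exists [seq 'X * u | u <- us] => x y; rewrite big_map.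
under eq_bigr do rewrite !hornerM !hornerX mulrACA.
by rewrite -mulr_sumr mulrCA -H !hornerM !hornerX; ring.
Qed.

Lemma bezout_pos_X f : bezout_pos f ('X * f).
Proof. by exists [:: f] => x y; rewrite big_seq1 !hornerM !hornerX; ring. Qed.

Definition rprod s : {poly R} := \prod_(a <- s) ('X - a%:P).

Lemma rprod_cons a s : rprod (a :: s) = ('X - a%:P) * rprod s.
Proof. by rewrite /rprod big_cons. Qed.

(** Let a be the largest root of g and b that of f, and write
    g = (x - a) g1 and f = (x - b) f1.  The Bezoutian of f and g equals
    (x - b) (y - b) times that of f1 and g1 plus (a - b) times that of g1 and f.
    Both pairs interlace again, and a >= b.  The bound on the size of the
    certificate is what allows it to be reversed. *)
Lemma count_interlace_bezout_cert s t : sorted >=%R s -> sorted >=%R t ->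
  count_interlace s t ->
  exists us, {in us, forall u :
    {poly R}, (size u <= size t)%N} /\ bezout_cert us (rprod s) (rprod t).
Proof.
move: {2}(size s + size t)%N (leqnn (size s + size t)) => n.
elim: n s t => [|n IHn] s [|a t].
- rewrite leqn0 addn0 => /nilP -> _ _ _; exists [::]; split=> // x y.
  by rewrite big_nil; ring.
- by rewrite addnS.
- move=> _ ss _ st; exists [::]; split=> // x y; rewrite big_nil.
  suff -> : s = [::] by ring.
  have [x0 [+ _]] := count_above_total s [::]; have := st x0.
  by rewrite /count_above /= leqn0 => /andP[/eqP-> _]; case: (s).
move=> szn ss st H.
have sa : all (fun b => b <= a) s.
  apply/allP => b bs; rewrite leNgt; apply/negP => ab.
  have := H a; rewrite (@count_above0 _ (a :: t));
    last by rewrite /= lexx sorted_head_max.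
  rewrite leqn0 => /andP[/eqP + _].
  by apply/eqP; rewrite -lt0n /count_above -has_count; apply/hasP; exists b.
have {}H := (flip_count_interlace sa (sorted_head_max st)).1 H.
have {}st := path_sorted st.
have [|us1 [szu1 H1]] := IHn t s _ st ss H; first by move: szn => /=; lia.
case: s ss sa H szn szu1 H1 => [|b s] ss sa H szn szu1 H1.
  exists [:: 1]; split=> [u|x y]; first by rewrite inE => /eqP ->;
    rewrite size_poly1.
  have -> : t = [::].
    have [x0 [+ _]] := count_above_total t [::]; have := H x0.
    by rewrite /count_above /= leqn0 => /andP[/eqP-> _]; case: (t).
  rewrite big_seq1 rprod_cons !hornerM /rprod big_nil !hornerE /=; ring.
have tb : all (fun c => c <= b) t.
  apply/allP => c ct; rewrite leNgt; apply/negP => bc.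
  have := H b; rewrite (@count_above0 _ (b :: s));
    last by rewrite /= lexx sorted_head_max.
  rewrite leqn0 => /andP[/eqP + _].
  by apply/eqP; rewrite -lt0n /count_above -has_count; apply/hasP; exists c.
have H' := (flip_count_interlace tb (sorted_head_max ss)).1 H.
have [|us2 [szu2 H2]] := IHn s t _ (path_sorted ss) st H';
  first by move: szn => /=; lia.
have ab : 0 <= a - b by move: sa => /= /andP[]; lra.
have szst : (size s <= size t)%N.
  by have [x0 []] := count_above_total s t; have := H' x0 => /[swap] ->
    /[swap] -> /andP[].
have szts : (size t <= (size s).+1)%N.
  by have [x0 []] := count_above_total s t; have := H' x0 => /[swap] ->
    /[swap] -> /andP[].
exists ([seq ('X - b%:P) * u | u <- us2] ++ [seq Num.sqrt (a - b) *: u | u <- us1]); split.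
  move=> u; rewrite mem_cat => /orP[] /mapP[v vus ->].
  - apply: leq_trans (size_polyMleq _ _) _; rewrite size_XsubC /=.
    by rewrite ltnS szu2.
  - apply: leq_trans (size_scale_leq _ _) _; apply: leq_trans (szu1 _ vus) _.
    by rewrite ltnS.
move=> x y; have {}H1 := bezout_cert_scale ab H1 x y; have {}H2 := H2 x y.
rewrite big_cat big_map /= mulrDr -H1.
have -> : \sum_(j <- us2) (('X - b%:P) * j).[x] * (('X - b%:P) * j).[y]
   = (x - b) * (y - b) * \sum_(u <- us2) u.[x] * u.[y].
  by rewrite mulr_sumr; apply: eq_bigr => u _;
    rewrite !hornerM !hornerXsubC mulrACA.
by rewrite mulrCA -H2 !rprod_cons !hornerE /=; ring.
Qed.

Lemma bezout_cert_poly us f g y : bezout_cert us f g ->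
  f.[y] *: g - g.[y] *: f = ('X - y%:P) * \sum_(u <- us) u.[y] *: u.
Proof.
move=> H; apply/eqP; rewrite -subr_eq0; apply/eqP/(@poly_natroots0 _ 0) => n _.
apply/eqP; rewrite !(hornerD, hornerN, hornerM, hornerZ, hornerC, hornerX, horner_sum).
rewrite subr_eq0; apply/eqP.
transitivity (g.[n%:R] * f.[y] - f.[n%:R] * g.[y]); first by ring.
by rewrite H; congr (_ * _); apply: eq_bigr => u _; rewrite hornerZ mulrC.
Qed.

(** The Bezoutian on the diagonal. *)
Definition wronskian f g := g^`() * f - g * f^`().

Lemma bezout_cert_wronskian us f g x : bezout_cert us f g ->
  (wronskian f g).[x] = \sum_(u <- us) u.[x] ^+ 2.
Proof.
move=> /(bezout_cert_poly x) H; have := congr1 (fun p => p^`().[x]) H => /=.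
rewrite derivM !derivE !hornerE subrr mul0r addr0 horner_sum.
rewrite (eq_bigr (fun u : {poly R} => u.[x] ^+ 2)); last by move=> u _;
  rewrite hornerZ expr2.
by move=> <-; ring.
Qed.

Lemma sum_sqr_eq0 us x : \sum_(u <- us) u.[x] ^+ 2 = 0 ->
  {in us, forall u, u.[x] = 0}.
Proof.
move/eqP; rewrite psumr_eq0; last by move=> u _; exact: sqr_ge0.
by move/allP => H u /H /=; rewrite sqrf_eq0 => /eqP.
Qed.

(** A sum of squares vanishes only if each u vanishes at x, and then so does
    the whole Bezoutian at (x, y) for every y. *)
Lemma bezout_cert_wronskian_eq0 us f g x : bezout_cert us f g ->
  (wronskian f g).[x] = 0 ->
  g.[x] *: f = f.[x] *: g.
Proof.
move=> H; rewrite (bezout_cert_wronskian _ H) => /sum_sqr_eq0 u0.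
have := bezout_cert_poly x H; rewrite big_seq big1 ?mulr0;
  last by move=> u /u0 ->; rewrite scale0r.
by move=> /eqP; rewrite subr_eq0 => /eqP ->.
Qed.

(** Both polynomials vanish at r, so the diagonal of the Bezoutian does too,
    every u has the root r, and (x - r) (y - r) can be cancelled. *)
Lemma bezout_pos_divXsub f g r : bezout_pos (('X - r%:P) * f)
  (('X - r%:P) * g) -> bezout_pos f g.
Proof.
move=> [us H].
have u0 : {in us, forall u, u.[r] = 0}.
  apply: sum_sqr_eq0;
    rewrite -(bezout_cert_wronskian _ H) /wronskian !derivE !hornerE /=; ring.
exists [seq u %/ ('X - r%:P) | u <- us].
apply: (@bezout_cert_nat _ _ _ _ (Num.bound `|r|)) => i j ri rj.
have neq (k : nat) : (Num.bound `|r| <= k)%N -> k%:R - r != 0.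
  move=> rk; rewrite subr_eq0; apply/eqP => rE.
  suff : (k%:R : R) < k%:R by rewrite ltxx.
  rewrite {1}rE; apply: le_lt_trans (ler_norm r) _.
  by apply: lt_le_trans (archi_boundP (normr_ge0 r)) _; rewrite ler_nat.
have := H i%:R j%:R; rewrite !hornerE big_map /=.
rewrite (eq_big_seq (fun u : {poly R} => (i%:R - r) * (j%:R - r) *
    ((u %/ ('X - r%:P)).[i%:R] * (u %/ ('X - r%:P)).[j%:R]))); last first.
  move=> u /u0 /eqP /factor_theorem [v ->]; rewrite mulpK ?polyXsubC_eq0 //.
  by rewrite !hornerE /=; ring.
rewrite -mulr_sumr => HH.
apply: (mulfI (neq _ ri)); apply: (mulfI (neq _ rj)).
have -> (A S D E : R) : A * (D * (E * S)) = E * (D * A * S) by ring.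
by rewrite -HH /=; ring.
Qed.

Lemma rprod_ge0 s x : all (fun a => a <= x) s -> 0 <= (rprod s).[x].
Proof.
move=> /allP sx; rewrite /rprod horner_prod big_seq prodr_ge0 // => a /sx.
by rewrite hornerXsubC subr_ge0.
Qed.

Lemma root_rprod s x : root (rprod s) x = (x \in s).
Proof. exact: root_prod_XsubC. Qed.

Lemma rprod_neq0 s : rprod s != 0.
Proof. by rewrite /rprod monic_neq0 // monic_prod_XsubC. Qed.

(** The largest root must belong to t: at a largest root r in s the
    Wronskian would be -g(r) f'(r) <= 0.  Removing it from t and exchanging the
    two polynomials divides the Wronskian at the remaining roots r by a - r, so
    the hypothesis persists and induction applies. *)
Lemma wronskian_count_interlace s t : sorted >=%R s -> sorted >=%R t ->
  (forall r, r \in s ++ t -> 0 < (wronskian (rprod s) (rprod t)).[r]) ->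
  count_interlace s t.
Proof.
move: {2}(size s + size t)%N (leqnn (size s + size t)) => n.
elim: n s t => [|n IHn] s t szn ss st W.
  by move: szn; rewrite leqn0 addn_eq0 => /andP[/nilP -> /nilP ->].
have noneg a s' t' : s = a :: s' -> t = t' -> all (fun b => b <= a) t' -> False.
  move=> sE tE ta; move: (W a); rewrite sE inE eqxx => /(_ isT).
  rewrite /wronskian rprod_cons !derivE !hornerE /= subrr !(mul0r, mulr0, addr0, add0r).
  rewrite oppr_gt0 ltNge mulr_ge0 ?rprod_ge0 ?tE //.
  by apply: sorted_head_max; rewrite -sE.
case: t szn st W noneg => [|a t] szn st W noneg.
  by case: s ss szn W noneg => // b s ss szn W /(_ b s [::] erefl erefl).
have sa : all (fun b => b <= a) s.
  case: s ss szn W noneg => // b s ss szn W noneg.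
  have ba : b <= a.
    rewrite leNgt; apply/negP => ab; apply: (noneg b s (a :: t)) => //=.
    by rewrite ltW //=; apply: sub_all (sorted_head_max st) => c /le_trans ->
      //; exact: ltW.
  by rewrite /= ba; apply: sub_all (sorted_head_max ss) => c /le_trans ->.
apply/(flip_count_interlace sa (sorted_head_max st)).
apply: IHn => //; [by move: szn => /=; lia|exact: path_sorted st|].
move=> r rts; have ra : 0 <= a - r.
  rewrite subr_ge0; move: rts; rewrite mem_cat => /orP[|/(allP sa)//].
  by move/(allP (sorted_head_max st)).
move: rts; rewrite mem_cat => rts; have := W r.
rewrite mem_cat inE orbCA [(r \in s) || _]orbC rts orbT => /(_ isT).
have -> : (wronskian (rprod s) (rprod (a :: t))).[r] =
   (a - r) * (wronskian (rprod t) (rprod s)).[r].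
  have st0 : (rprod s).[r] * (rprod t).[r] = 0.
    by apply/eqP; rewrite mulf_eq0 -!/(root _ _) !root_rprod orbC.
  rewrite /wronskian rprod_cons !derivE !hornerE /=.
  (* The two sides differ by f(r) g1(r), which is zero as r is a root. *)
  rewrite -[RHS]addr0 -st0; ring.
move=> Wr; rewrite lt_def; apply/andP; split.
  by apply: contraTneq Wr => ->; rewrite mulr0 ltxx.
rewrite leNgt; apply/negP => W0; move: Wr; apply/negP; rewrite -leNgt.
by rewrite mulr_ge0_le0 // ltW.
Qed.

(** If the Wronskian vanished at r, then g(r) f = f(r) g, although exactly one
    of f(r) and g(r) is zero. *)
Lemma bezout_cert_no_common_root us f g r : bezout_cert us f g -> f != 0 ->
  g != 0 ->
  root f r || root g r -> ~~ (root f r && root g r) -> 0 < (wronskian f g).[r].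
Proof.
move=> H f0 g0 fgr nfg; rewrite lt_def (bezout_cert_wronskian _ H) andbC.
rewrite sumr_ge0 /=; last by move=> u _; exact: sqr_ge0.
rewrite -(bezout_cert_wronskian _ H); apply/eqP =>
  /(bezout_cert_wronskian_eq0 H) E.
case/orP: fgr nfg E => [] r0;
  rewrite r0 /= ?andbT (rootP r0) scale0r /root => /negPf n0.
- by move/eqP; rewrite scaler_eq0 (negPf f0) orbF n0.
- by move/esym/eqP; rewrite scaler_eq0 (negPf g0) orbF n0.
Qed.

(** A common root is cancelled from both sides and changes both counts
    alike; without common roots the Wronskian is positive at all roots. *)
Lemma bezout_pos_count_interlace s t : bezout_pos (rprod s) (rprod t) ->
  count_interlace s t.
Proof.
have [n] := ubnP (size s); elim: n s t => // n IHn s t szs B.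
have [/hasP[r rs rt]|/hasPn nst] := boolP (has (mem t) s).
- have ps := perm_to_rem rs; have pt := perm_to_rem rt.
  suff H : count_interlace (rem r s) (rem r t).
    apply: (count_interlace_perm (s := r :: rem r s) (t := r :: rem r t)).
    + by rewrite perm_sym.
    + by rewrite perm_sym.
    + by move=> x; move: (H x); rewrite !count_above_cons; lia.
  apply: IHn; first by rewrite size_rem //; case: (s) rs szs.
  apply: (@bezout_pos_divXsub _ _ r).
  by rewrite -!rprod_cons /rprod -(perm_big _ ps) -(perm_big _ pt).
- case: B => us H.
  have ps : perm_eq (sort >=%R s) s by rewrite perm_sort.
  have pt : perm_eq (sort >=%R t) t by rewrite perm_sort.
  apply: (count_interlace_perm ps pt).
  apply: wronskian_count_interlace; rewrite ?sort_sorted //;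
    try exact: ge_total.
  move=> r; rewrite mem_cat !mem_sort => rst.
  rewrite /rprod (perm_big _ ps) (perm_big _ pt) /=.
  apply: bezout_cert_no_common_root H _ _ _ _;
    rewrite ?rprod_neq0 ?root_rprod //.
  by apply/negP => /andP[/nst /negP]; apply.
Qed.

Local Notation toC := (map_poly (real_complex R)).

Lemma conj_toC (p : {poly R}) (z : R[i]) : (toC p).[z^*] = ((toC p).[z])^*.
Proof.
rewrite -horner_map -map_poly_comp /=; congr (_.[_]).
by apply: eq_map_poly => x /=; rewrite /Num.conj /= oppr0.
Qed.

(** If g(z) = 0 with z not real, the Bezoutian at (z, conj z) is zero and
    equals the sum of the |u(z)|^2.  So every u vanishes at z, the Bezoutian at
    (z, w) vanishes for all w, that is f(z) g(w) = 0 for all w, while f(z) is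
    nonzero. *)
Lemma bezout_pos_real_rooted f g : f != 0 -> real_rooted f ->
  bezout_pos f g -> real_rooted g.
Proof.
move=> f0 [/eqP|rf]; first by rewrite (negPf f0).
move=> [us H]; have [->|g0] := eqVneq g 0; [by left|right=> z gz].
apply: contraNT g0 => nz.
have {}H := bezout_cert_map (real_complex R) H.
have u0 : {in us, forall u, (toC u).[z] = 0}.
  have := H z (z^*);
    rewrite !conj_toC (rootP gz) conjC0 mul0r mulr0 subrr big_map.
  move/esym/eqP; rewrite mulf_eq0 subr_eq0 => /orP[/eqP E|].
    by move: nz; rewrite CrealE -E eqxx.
  under eq_bigr do rewrite conj_toC -normCK.
  rewrite psumr_eq0; last by move=> u _; exact: exprn_ge0.
  by move/allP => HH u /HH /=; rewrite sqrf_eq0 normr_eq0 => /eqP.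
have fz : (toC f).[z] != 0 by apply: contra nz => /rf.
rewrite -(map_poly_eq0 (real_complex R)); apply/eqP.
apply: (@poly_natroots0 _ 0) => n _; have := H z n%:R.
rewrite (rootP gz) mul0r sub0r big_map big_seq big1 ?mulr0;
  last by move=> u /u0 ->; rewrite mul0r.
by move/eqP; rewrite oppr_eq0 mulf_eq0 (negPf fz) => /eqP.
Qed.

Lemma real_rooted_split f : f != 0 -> real_rooted f ->
  exists s, sorted >=%R s /\ f = lead_coef f *: rprod s.
Proof.
move=> f0 [/eqP|rf]; first by rewrite (negPf f0).
have [r rE] := closed_field_poly_normal (toC f).
have rR : r = [seq real_complex R (complex.Re z) | z <- r].
  rewrite -[LHS]map_id; apply/eq_in_map => z zr.
  suff : z \is Num.real by move=> /RRe_real {1}<-; rewrite ?complexRe.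
  apply: rf; rewrite rE rootZ ?root_prod_XsubC //.
  by rewrite lead_coef_eq0 map_poly_eq0.
exists (sort >=%R [seq complex.Re z | z <- r]); split;
  first exact/sort_sorted/ge_total.
apply: (map_poly_inj (real_complex R)).
rewrite rE linearZ /= lead_coef_map; congr (_ *: _).
rewrite /rprod (perm_big _ (permEl (perm_sort _ _))) /= rmorph_prod big_map {1}rR big_map.
by apply: eq_bigr => z _; rewrite rmorphB /= map_polyX map_polyC.
Qed.
End Bezout.

(** * Reversal of polynomials *)

Section Reversal.
Variable R : realType.
Implicit Types (p q : {poly R}) (n : nat).

Lemma horner_reversal n p x : (size p <= n.+1)%N -> x != 0 ->
  (reversal n p).[x] = x ^+ n * p.[x^-1].
Proof.
move=> sp x0; rewrite horner_poly (horner_coef_wide _ sp) mulr_sumr.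
rewrite (reindex_inj rev_ord_inj) /=; apply: eq_bigr => i _.
have le_in : (i <= n)%N by rewrite -ltnS.
rewrite subSS subKn // mulrCA; congr (_ * _).
by rewrite exprB ?unitfE // exprVn.
Qed.

(** The substitution x -> 1/x, y -> 1/y turns x - y into (y - x) / (x y),
    which exchanges the two polynomials. *)
Lemma bezout_cert_reversal n us (f g : {poly R}) :
  {in us, forall u : {poly R}, (size u <= n.+1)%N} ->
  (size f <= n.+2)%N -> (size g <= n.+2)%N -> bezout_cert us f g ->
  bezout_cert (map (reversal n) us) (reversal n.+1 g) (reversal n.+1 f).
Proof.
move=> su sf sg H; apply: (@bezout_cert_nat _ _ _ _ 1) => i j i1 j1.
have i0 : i%:R != 0 :> R by rewrite pnatr_eq0 -lt0n.
have j0 : j%:R != 0 :> R by rewrite pnatr_eq0 -lt0n.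
rewrite big_map !horner_reversal //.
rewrite (eq_big_seq (fun u : {poly R} =>
  i%:R ^+ n * j%:R ^+ n * (u.[i%:R^-1] * u.[j%:R^-1]))); last first.
  by move=> u us_u; rewrite !horner_reversal ?su // mulrACA.
rewrite -mulr_sumr; have := H i%:R^-1 j%:R^-1; set S := \sum_(u <- us) _ => HS.
have -> : (i%:R - j%:R) * (i%:R ^+ n * j%:R ^+ n * S) =
  - (i%:R ^+ n.+1 * j%:R ^+ n.+1 * ((i%:R^-1 - j%:R^-1) * S)).
  by rewrite !exprS; field; rewrite i0 j0.
by rewrite -HS; ring.
Qed.

Lemma reversal_eq n p q : (size p <= n.+1)%N ->
  (forall x : R, x != 0 -> q.[x] = x ^+ n * p.[x^-1]) -> reversal n p = q.
Proof.
move=> sp qE; apply/eqP; rewrite -subr_eq0; apply/eqP;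
  apply: (@poly_natroots0 _ 1) => i i1.
have i0 : i%:R != 0 :> R by rewrite pnatr_eq0 -lt0n.
by rewrite hornerD hornerN qE // horner_reversal // subrr.
Qed.

Lemma reversalD n p q : reversal n (p + q) = reversal n p + reversal n q.
Proof. by apply/polyP => i; rewrite coefD !coef_poly; case: ifP;
  rewrite ?coefD ?addr0. Qed.

Lemma reversalN n p : reversal n (- p) = - reversal n p.
Proof. by apply/polyP => i; rewrite coefN !coef_poly; case: ifP;
  rewrite ?coefN ?oppr0. Qed.

Lemma reversalK n p : (size p <= n.+1)%N -> reversal n (reversal n p) = p.
Proof.
move=> sp; apply/polyP => i; rewrite coef_poly; case: ltnP => [ilt|nle];
  last first.
  by rewrite nth_default // (leq_trans sp).
by rewrite coef_poly ltnS leq_subr subKn.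
Qed.

Lemma reversal_lift n p : (size p <= n.+1)%N -> reversal n.+1 p =
  'X * reversal n p.
Proof.
move=> sp; apply/polyP => -[|i]; rewrite coefXM coef_poly /=.
  by rewrite subn0 nth_default.
by rewrite ltnS subSS coef_poly.
Qed.

Lemma reversal_XM n p : (size p <= n.+1)%N -> reversal n.+1 ('X * p) =
  reversal n p.
Proof.
move=> sp; apply/polyP => i; rewrite !coef_poly coefXM.
case: (ltngtP i n.+1) => [ilt|ilt|->].
- by rewrite ltnS (ltnW ilt) subn_eq0 leqNgt ilt /= subSn.
- by rewrite ltnNge ilt.
- by rewrite ltnSn subnn.
Qed.

End Reversal.

(** * Sums over intervals of a Boolean lattice *)

(** The sum expands a product over T with factor 0 at every element of
    B that is not in A. *)
Lemma sum_interval (R : comRingType) (T : finType) (A B : {set T}) :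
  A \subset B ->
  \sum_(X : {set T} | (A \subset X) && (X \subset B)) (-1) ^+ #|X| =
  (-1) ^+ #|B| *+ (A == B) :> R.
Proof.
move=> AB.
pose F i : R := if i \in B then -1 else 0.
pose G i : R := if i \in A then 0 else 1.
have prodE (X : {set T}) : \prod_i (if i \in X then F i else G i) =
    (-1) ^+ #|X| *+ ((A \subset X) && (X \subset B)).
  have [/subsetP AX|/subsetPn[i iA iX]] := boolP (A \subset X); last first.
    by rewrite (bigD1 i) //= (negPf iX) /G iA mul0r.
  have [/subsetP XB|/subsetPn[i iX iB]] := boolP (X \subset B); last first.
    by rewrite (bigD1 i) //= iX /F (negPf iB) mul0r.
  rewrite /= mulr1n -prodr_const [RHS]big_mkcond /=; apply: eq_bigr => i _.
  case: ifP => [iX|/negbT iX]; rewrite /F /G ?XB //.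
  by rewrite (negPf (contra (AX i) iX)).
transitivity (\prod_i (F i + G i)).
  rewrite bigA_distr big_mkcond /=; apply: eq_bigr => X _.
  by rewrite prodE; case: ifP.
have [ABe|/eqP AnB] := eqVneq A B.
  rewrite -ABe -prodr_const [RHS]big_mkcond /=; apply: eq_bigr => i _.
  by rewrite /F /G -ABe; case: (i \in A); rewrite ?addr0 ?add0r.
have /properP[_ [i iB iA]] : A \proper B by rewrite properEneq AB andbT;
  apply/eqP.
by rewrite (bigD1 i) //= /F /G iB (negPf iA) addNr mul0r.
Qed.

(** Expand the product over T whose factors are x + y on B and 1 elsewhere. *)
Lemma sum_subsets (R : comRingType) (T : finType) (B : {set T}) (x y : R) :
  \sum_(X : {set T} | X \subset B) x ^+ #|X| * y ^+ (#|B| - #|X|) =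
    (x + y) ^+ #|B|.
Proof.
pose F i : R := if i \in B then x else 0.
pose G i : R := if i \in B then y else 1.
transitivity (\prod_i (F i + G i)); last first.
  rewrite -prodr_const [RHS]big_mkcond /=; apply: eq_bigr => i _.
  by rewrite /F /G; case: ifP; rewrite ?add0r.
rewrite bigA_distr big_mkcond /=; apply: eq_bigr => X _.
case: ifPn => [/[dup] XB /subsetP XB'|/subsetPn[i iX iB]]; last first.
  by rewrite (bigD1 i) //= iX /F (negPf iB) mul0r.
rewrite -(setIidPr XB) -cardsD (setIidPr XB) -!prodr_const.
rewrite [X in X * _]big_mkcond [X in _ * X]big_mkcond -big_split /=;
  apply: eq_bigr => i _.
rewrite inE /F /G; case: ifP => [/XB' -> |_]; rewrite ?mulr1 ?mul1r //=.
Qed.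

(** * Complete simplicial fans on an orthant *)

Lemma infinite_pigeonhole (T : finType) (g : nat -> T) :
  exists t, forall N, exists2 n, (N <= n)%N & g n = t.
Proof.
apply: contrapT => H.
have {}H t : exists N, forall n, (N <= n)%N -> g n <> t.
  apply: contrapT => Ht; apply: H; exists t => N.
  apply: contrapT => HN; apply: Ht; exists N => n Nn gn; apply: HN.
  by exists n.
have [b bP] := choice H.
pose N := \max_t b t.
by apply: (bP (g N) N) => //; apply: leq_bigmax.
Qed.

Section Fan.
Variables (R : realType) (m : nat) (V : finType).
Variables (D : {set {set V}}) (a : V -> 'rV[R]_m).

Implicit Types (G H S X : {set V}) (c e k : V -> R) (w : 'rV[R]_m).

Definition cone_point (G : {set V}) (c : V -> R) : 'rV[R]_m :=
  \sum_(v in G) c v *: a v.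

Definition orthant (x : 'rV[R]_m) := forall j, 0 <= x 0 j.

(** The cones spanned by the vectors a v, for v in a face of D, are
    simplicial and their relative interiors partition the nonnegative orthant.
    The coning of a triangulation of the standard simplex is such a fan; cones
    avoid the affine bookkeeping of simplices. *)
Record orthant_fan : Prop := OrthantFan {
  fan_complex : simplicial_complex D;
  fan_orthant : forall v, [set v] \in D -> orthant (a v);
  fan_free : forall G c, G \in D -> cone_point G c = 0 ->
    {in G, forall v, c v = 0};
  fan_cover : forall x, orthant x -> exists G c,
    [/\ G \in D, {in G, forall v, 0 < c v} & x = cone_point G c];
  fan_unique : forall G H c e, G \in D -> H \in D ->
    {in G, forall v, 0 < c v} -> {in H, forall v, 0 < e v} ->
    cone_point G c = cone_point H e -> G = H }.

Hypothesis F : orthant_fan.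

Lemma fan_sub G H : H \in D -> G \subset H -> G \in D.
Proof. by move=> HD GH; have [_] := fan_complex F; apply; [exact: HD|]. Qed.

Lemma cone_point_ext G c e : {in G, c =1 e} -> cone_point G c = cone_point G e.
Proof. by move=> ce; apply: eq_bigr => v vG; rewrite ce. Qed.

Lemma cone_pointD G c e : cone_point G c + cone_point G e =
  cone_point G (fun v => c v + e v).
Proof. by rewrite -big_split; apply: eq_bigr => v _; rewrite scalerDl. Qed.

Lemma cone_pointZ G c (k : R) : k *: cone_point G c =
  cone_point G (fun v => k * c v).
Proof. by rewrite scaler_sumr; apply: eq_bigr => v _; rewrite scalerA. Qed.

Lemma cone_pointB G c e : cone_point G c - cone_point G e =
  cone_point G (fun v => c v - e v).
Proof. by rewrite -sumrB; apply: eq_bigr => v _; rewrite scalerBl. Qed.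

Lemma fan_inj G c e : G \in D -> cone_point G c = cone_point G e ->
  {in G, c =1 e}.
Proof.
move=> GD E v vG; apply/eqP; rewrite -subr_eq0; apply/eqP.
by apply: (fan_free F GD (c := fun v => c v - e v)) vG;
  rewrite -cone_pointB E subrr.
Qed.

Lemma cone_point_sub G H c : G \subset H ->
  {in H, forall v, v \notin G -> c v = 0} ->
  cone_point H c = cone_point G c.
Proof.
move=> GH c0;
  rewrite /cone_point [LHS](bigID (mem G)) /= [X in _ + X]big1 ?addr0.
  by apply: eq_bigl => v; case vG: (v \in G);
    rewrite ?andbF ?andbT ?(subsetP GH).
by move=> v /andP[vH vG]; rewrite c0 // scale0r.
Qed.

Definition face_mx (G : {set V}) : 'M[R]_(#|G|, m) := \matrix_i a (enum_val i).

Lemma face_mx_mul (G : {set V}) (c : 'rV[R]_#|G|) (e : V -> R) :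
  (forall i, c 0 i = e (enum_val i)) -> c *m face_mx G = cone_point G e.
Proof.
move=> ce; rewrite mulmx_sum_row /cone_point [RHS]big_enum_val.
by apply: eq_bigr => i _; rewrite rowK ce.
Qed.

Lemma fan_row_free G : G \in D -> row_free (face_mx G).
Proof.
move=> GD; rewrite -kermx_eq0; apply/rowV0P => c /sub_kermxP c0.
have [/eq_leq G0|/card_gt0P[v0 v0G]] := posnP #|G|.
  by apply/rowP => i; have := leq_trans (ltn_ord i) G0.
pose e v := c 0 (enum_rank_in v0G v).
have ce i : c 0 i = e (enum_val i) by rewrite /e enum_valK_in.
apply/rowP => i; rewrite mxE ce.
by apply: (fan_free F GD) (enum_valP i); rewrite -(face_mx_mul ce).
Qed.

Lemma fan_card G : G \in D -> (#|G| <= m)%N.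
Proof. by move=> /fan_row_free /eqP <-; exact: rank_leq_col. Qed.

(** The vectors of G are independent and lie in the coordinate subspace of
    J. *)
Lemma fan_card_supp G (J : {set 'I_m}) : G \in D ->
  {in G, forall v j, j \notin J -> a v 0 j = 0} -> (#|G| <= #|J|)%N.
Proof.
move=> GD supp.
pose A : 'M[R]_(#|G|, #|J|) := \matrix_(i, j) a (enum_val i) 0 (enum_val j).
suff : row_free A by move=> /eqP <-; exact: rank_leq_col.
rewrite -kermx_eq0; apply/rowV0P => c /sub_kermxP c0.
have := fan_row_free GD; rewrite -kermx_eq0 => /eqP K0.
suff : (c <= kermx (face_mx G))%MS by rewrite K0 submx0 => /eqP.
apply/sub_kermxP/rowP => j; rewrite !mxE.
have [jJ|jJ] := boolP (j \in J); last first.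
  by rewrite big1 // => i _; rewrite mxE supp ?mulr0 // enum_valP.
have := congr1 (fun M : 'rV__ => M 0 (enum_rank_in jJ j)) c0; rewrite !mxE => E.
by rewrite -[RHS]E; apply: eq_bigr => i _; rewrite !mxE enum_rankK_in.
Qed.

Lemma facet_coords S (w : 'rV[R]_m) : S \in D -> #|S| = m ->
  exists k, w = cone_point S k.
Proof.
move=> SD Sm.
have full : row_full (face_mx S)
  by rewrite /row_full (eqP (fan_row_free SD)) Sm.
have /submxP[c wE] : (w <= face_mx S)%MS by exact: submx_full.
have [S0|/card_gt0P[v0 v0S]] := posnP #|S|.
  exists (fun => 0); rewrite wE; apply/rowP => j; exfalso.
  by have := ltn_ord j; rewrite -[X in (_ < X)%N]Sm S0.
exists (fun v => c 0 (enum_rank_in v0S v)).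
by rewrite wE; apply: face_mx_mul => i; rewrite enum_valK_in.
Qed.

(** Outside the span of every cone that is not full-dimensional. *)
Definition generic (w : 'rV[R]_m) :=
  forall G c, G \in D -> (#|G| < m)%N -> w <> cone_point G c.

(** Points (1, t, t^2, ...) of the moment curve with t > 0 are positive.
    Every cone of smaller dimension lies in a hyperplane, and a hyperplane meets
    the curve where a nonzero polynomial in t vanishes. *)
Lemma generic_exists : exists2 w, generic w & forall j, 0 < w 0 j.
Proof.
have ann (G : {set V}) : exists n : 'cV[R]_m, (#|G| < m)%N ->
  n != 0 /\ face_mx G *m n = 0.
  case: (ltnP #|G| m) => Gm; last by exists 0.
  have : cokermx (face_mx G) != 0.
    rewrite -mxrank_eq0 mxrank_coker -lt0n subn_gt0.
    by apply: leq_ltn_trans Gm; exact: rank_leq_row.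
  move=> /matrix0Pn[i [j nz]]; exists (col j (cokermx (face_mx G))) => _; split.
    by apply/cV0Pn; exists i; rewrite mxE.
  by rewrite colE mulmxA mulmx_coker mul0mx.
have [nv nvP] := choice ann.
(* nv G is normal to the cone of G, so P G vanishes at every t for which the
   point of the moment curve lies in the span of that cone. *)
pose P (G : {set V}) : {poly R} := \sum_(j < m) nv G j 0 *: 'X^j.
pose Q := \prod_(G : {set V} | (#|G| < m)%N) P G.
have Q0 : Q != 0.
  apply/prodf_neq0 => G Gm; have [/cV0Pn[j nj] _] := nvP G Gm.
  apply: contraNneq nj => /(congr1 (fun p : {poly R} => p`_j)).
  rewrite coef0 coef_sum (bigD1 j) //= big1 ?addr0; last first.
    by move=> i /negPf ij;
      rewrite coefZ coefXn (inj_eq val_inj) eq_sym ij mulr0.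
  by rewrite coefZ coefXn eqxx mulr1 => ->.
have [t t1 Qt] : exists2 t : nat, (1 <= t)%N & Q.[t%:R] != 0.
  apply: contrapT => H; move/eqP: Q0; apply; apply: (@poly_natroots0 _ 1) =>
    t t1.
  by apply/eqP; apply: contrapT => /negP Qt; apply: H; exists t.
exists (\row_j t%:R ^+ j) => [G c GD Gm wE|j];
  last by rewrite mxE exprn_gt0 // ltr0n.
move: Qt; rewrite horner_prod => /prodf_neq0 /(_ G Gm) /eqP; apply.
have [_ ann0] := nvP G Gm.
have : (\row_j t%:R ^+ j) *m nv G = 0.
  rewrite wE.
  have [G0|/card_gt0P[v0 v0G]] := posnP #|G|.
    by rewrite /cone_point big_pred0 ?mul0mx // => v; rewrite (card0_eq G0).
  rewrite -(@face_mx_mul G (\row_i c (enum_val i))); last by move=> i;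
    rewrite mxE.
  by rewrite -mulmxA ann0 mulmx0.
move=> /(congr1 (fun M : 'M_1 => M 0 0)); rewrite !mxE => E0.
rewrite -[RHS]E0 /P horner_sum; apply: eq_bigr => j _.
by rewrite hornerZ hornerXn mxE mulrC.
Qed.

Lemma genericN w : generic w -> generic (- w).
Proof.
move=> gw G c GD Gm wE; apply: (gw G (fun v => -1 * c v) GD Gm).
by rewrite -cone_pointZ -wE scaleN1r opprK.
Qed.

(** From the relative interior of the cone of G, a small step in the
    direction w leads into the interior of the full-dimensional cone of S. *)
Definition enters (w : 'rV[R]_m) (G S : {set V}) :=
  [/\ S \in D, #|S| = m, G \subset S &
    exists2 k, w = cone_point S k & {in S, forall v, v \notin G -> 0 < k v}].

Definition center G := cone_point G (fun => 1).

Lemma center_shiftE G (e : R) w j : (center G + e *: w) 0 j =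
  center G 0 j + e * w 0 j.
Proof. by rewrite !mxE. Qed.

Lemma enters_small w G S : enters w G S -> exists2 d : R, 0 < d &
  forall e : R, 0 < e -> e <= d ->
  exists2 c, {in S, forall v, 0 < c v} & center G + e *: w = cone_point S c.
Proof.
move=> [SD Sm GS [k wE kpos]].
pose K := 1 + \sum_(v in S) `|k v|.
have K0 : 0 < K by rewrite ltr_pwDl // sumr_ge0.
(* With this step, the change of a coordinate stays below 1, its value on G. *)
exists K^-1; first by rewrite invr_gt0.
move=> e e0 eK; exists (fun v => (v \in G)%:R + e * k v) => [v vS|].
  have [vG|vG] := boolP (v \in G); last by rewrite add0r mulr_gt0 // kpos.
  have : e * `|k v| < 1.
    apply: le_lt_trans (_ : K^-1 * `|k v| < 1); first exact: ler_wpM2r.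
    rewrite mulrC ltr_pdivrMr // mul1r /K (bigD1 v) //= addrCA ltrDl.
    by rewrite ltr_pwDl // sumr_ge0.
  have := ler_norm (- (e * k v)); rewrite normrN normrM (gtr0_norm e0) /=; lra.
rewrite -cone_pointD wE cone_pointZ; congr (_ + _).
rewrite (cone_point_sub GS); last by move=> v _ /negPf ->.
by apply: cone_point_ext => v ->.
Qed.

Lemma enters_unique w G S S' : enters w G S -> enters w G S' -> S = S'.
Proof.
move=> eS eS'; have [d d0 H] := enters_small eS; have [d' d0' H'] :=
  enters_small eS'.
pose e := Num.min d d'; have e0 : 0 < e by rewrite lt_min d0.
have [|c cp E] := H e e0; first by rewrite ge_min lexx.
have [|c' cp' E'] := H' e e0; first by rewrite ge_min lexx orbT.
case: eS => SD _ _ _; case: eS' => SD' _ _ _.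
by apply: (fan_unique F SD SD' cp cp'); rewrite -E -E'.
Qed.

(** Among the points center G + (d/(n+1)) w, infinitely many lie in the
    relative interior of one cone S.  Two of them show that w is in the span of
    S, so S is full-dimensional because w is generic.  Since the points tend to
    center G, the coordinates of center G in S are nonnegative, and where they
    vanish those of w are positive. *)
Lemma enters_exists w G (d : R) : generic w -> G \in D -> 0 < d ->
  (forall e : R, 0 < e -> e <= d -> orthant (center G + e *: w)) ->
    exists S, enters w G S.
Proof.
move=> gw GD d0 orth.
pose e (n : nat) := d / n.+1%:R.
have e0 n : 0 < e n by rewrite divr_gt0 // ltr0n.
have ed n : e n <= d by rewrite ler_pdivrMr ?ltr0n // ler_peMr ?ler1n // ltW.
have cov n : exists S : {set V}, exists c,
   [/\ S \in D, {in S, forall v, 0 < c v} & center G + e n *: w =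
     cone_point S c].
  exact: (fan_cover F (orth _ (e0 n) (ed n))).
have [Sn SnP] := choice cov.
have [S Sinf] := infinite_pigeonhole Sn.
have SD : S \in D by have [n _ <-] := Sinf 0%N; have [c []] := SnP n.
have {SnP} cn N : exists n c, [/\ (N <= n)%N, {in S, forall v, 0 < c v} &
    center G + e n *: w = cone_point S c].
  have [n Nn nS] := Sinf N; have [c [_ cp cE]] := SnP n.
  by exists n, c; rewrite -nS.
have e_small dl : 0 < dl -> exists N, forall n, (N <= n)%N -> e n < dl.
  (* d / (n + 1) < dl as soon as n exceeds d / dl. *)
  move=> dl0; exists (Num.bound (d / dl)) => n Nn.
  rewrite /e ltr_pdivrMr ?ltr0n // mulrC -ltr_pdivrMr //.
  apply: lt_le_trans (archi_boundP _) _; first by rewrite divr_ge0 // ltW.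
  by rewrite ler_nat (leq_trans Nn).
have [k wE] : exists k, w = cone_point S k.
  have [n1 [c1 [_ _ E1]]] := cn 0%N; have [n2 [c2 [n12 _ E2]]] := cn n1.+1.
  have e12 : e n1 - e n2 != 0.
    rewrite subr_eq0 /e; apply/eqP => /(mulfI (lt0r_neq0 d0)) /invr_inj /eqP.
    by rewrite eqr_nat eqSS ltn_eqF.
  exists (fun v => (e n1 - e n2)^-1 * (c1 v - c2 v)).
  rewrite -cone_pointZ -cone_pointB -E1 -E2 opprD addrACA subrr add0r -scalerBl.
  by rewrite scalerA mulVf ?scale1r.
have Sm : #|S| = m.
  by apply/eqP; rewrite eqn_leq fan_card //= leqNgt; apply/negP => /(gw S k SD).
have [p pE] := facet_coords (center G) SD Sm.
have pos N : exists2 n, (N <= n)%N & {in S, forall v, 0 < p v + e n * k v}.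
  have [n [c [Nn cp cE]]] := cn N; exists n => // v vS.
  suff <- : c v = p v + e n * k v by apply: cp.
  apply: (@fan_inj S c (fun v => p v + e n * k v)) => //.
  by rewrite -cE pE wE cone_pointZ cone_pointD.
have p0 v : v \in S -> 0 <= p v.
  move=> vS; rewrite leNgt; apply/negP => pv.
  have k1 : 0 < 1 + `|k v| by rewrite ltr_pwDl.
  have q0 : 0 < - p v / (1 + `|k v|) by rewrite divr_gt0 ?oppr_gt0.
  have [N Nsmall] := e_small _ q0; have [n Nn /(_ v vS)] := pos N.
  have := Nsmall n Nn; rewrite (ltr_pdivlMr _ _ k1) => en.
  have : e n * k v <= e n * (1 + `|k v|).
    by rewrite ler_wpM2l ?(ltW (e0 n)) // (le_trans (ler_norm _)) // lerDr.
  by lra.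
(* Uniqueness of the cone containing center G identifies G with this face. *)
pose G' := [set v in S | 0 < p v].
have G'S : G' \subset S by apply/subsetP => v; rewrite inE => /andP[].
have GG' : G = G'.
  apply: (fan_unique F GD (fan_sub SD G'S) (c := fun => 1) (e := p)).
  - by move=> v _; exact: ltr01.
  - by move=> v; rewrite inE => /andP[].
  rewrite -/(center G) pE; apply: cone_point_sub => // v vS;
    rewrite inE vS /= -leNgt => pv.
  by apply/eqP; rewrite eq_le pv p0.
exists S; split=> //; first by rewrite GG'.
exists k => // v vS; rewrite GG' inE vS /= -leNgt => pv.
have pv0 : p v = 0 by apply/eqP; rewrite eq_le pv p0.
have [n _ /(_ v vS)] := pos 0%N; rewrite pv0 add0r pmulr_rgt0 //.
Qed.

(** The smallest face of the orthant containing the cone of G. *)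
Definition carrier G := [set j | center G 0 j != 0].

Lemma fan_ge0 G v j : G \in D -> v \in G -> 0 <= a v 0 j.
Proof.
by move=> GD vG; apply: (fan_orthant F); apply: (fan_sub GD); rewrite sub1set.
Qed.

Lemma cone_point_ge0 G c j : G \in D -> {in G, forall v, 0 < c v} ->
  0 <= cone_point G c 0 j.
Proof.
move=> GD cp; rewrite summxE sumr_ge0 // => v vG.
by rewrite mxE mulr_ge0 ?(fan_ge0 _ GD) // ltW ?cp.
Qed.

Lemma center_ge0 G j : G \in D -> 0 <= center G 0 j.
Proof. by move=> GD; apply: cone_point_ge0 => // v _; exact: ltr01. Qed.

Lemma carrier_subset G (J : {set 'I_m}) : G \in D ->
  (carrier G \subset J) =
    [forall v in G, forall j, (j \notin J) ==> (a v 0 j == 0)].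
Proof.
move=> GD; have cE j : center G 0 j = \sum_(v in G) a v 0 j.
  by rewrite summxE; apply: eq_bigr => v _; rewrite mxE mul1r.
apply/subsetP/'forall_in_forallP => [GJ v vG j|H j].
  apply/implyP; apply: contraR => aj; apply: GJ; rewrite inE cE.
  rewrite psumr_neq0; last by move=> u uG; exact: (fan_ge0 _ GD).
  by apply/hasP; exists v;
    rewrite ?mem_index_enum //= vG lt_def aj (fan_ge0 _ GD vG).
rewrite inE cE; apply: contraR => jJ; rewrite big1 // => v vG.
by apply/eqP; have /implyP := H v vG j; apply.
Qed.

(** Take a generic w in the interior of the orthant.  Every cone X is left
    in the direction w into exactly one full-dimensional cone S, so the sum can
    be grouped by S.  The X belonging to S are those between N and S, where N
    is spanned by the vertices of S at which w has a negative coordinate.  The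
    alternating sum over the X that also contain G is zero unless every vertex
    of S outside G is in N, which means that S is entered from G in the
    direction -w.  Such an S exists, and is then unique, exactly when a small
    step from G in the direction -w stays in the orthant, that is when the cone
    of G meets the interior of the orthant. *)
Theorem fan_euler G : G \in D ->
  \sum_(X in D | G \subset X) (-1) ^+ #|X| =
    (-1) ^+ m *+ (carrier G == setT) :> {poly R}.
Proof.
move=> GD; have [w gw w0] := generic_exists.
(* K S v will be the coordinate of w at the vertex v of a facet S. *)
have coords S : exists k, S \in D /\ #|S| = m -> w = cone_point S k.
  have [[SD Sm]|nS] := pselect (S \in D /\ #|S| = m); last by exists (fun => 0).
  by have [k kE] := facet_coords w SD Sm; exists k.
have [K KP] := choice coords.
pose facet S := (S \in D) && (#|S| == m).
have facetP S : facet S -> S \in D /\ #|S| = m by case/andP => ? /eqP.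
have entersP X S : reflect (enters w X S)
    [&& facet S, X \subset S & [forall v in S, (v \notin X) ==> (0 < K S v)]].
  apply: (iffP and3P) =>
    [[/facetP[SD Sm] XS /forall_inP H]|[SD Sm XS [k wE kp]]].
    by split=> //; exists (K S); [exact: KP|move=> v vS; apply/implyP/H].
  split=> //; first by rewrite /facet SD Sm eqxx.
  apply/forall_inP => v vS; apply/implyP => vX.
  by rewrite -(@fan_inj S k (K S)) ?kp // -wE -KP.
have entersNP X S : reflect (enters (- w) X S)
    [&& facet S, X \subset S & [forall v in S, (v \notin X) ==> ~~ (0 < K S v)]].
  apply: (iffP and3P) =>
    [[/facetP[SD Sm] XS /forall_inP H]|[SD Sm XS [k wE kp]]].
    split=> //; exists (fun v => -1 * K S v).
      by rewrite -cone_pointZ -KP // scaleN1r.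
    move=> v vS vX; have /implyP/(_ vX) := H v vS.
    rewrite -leNgt mulN1r oppr_gt0 lt_def => -> /=; rewrite andbT eq_sym.
    apply/eqP => Kv0; apply: (gw (S :\ v) (K S)).
    - by apply: (fan_sub SD); exact: subsetDl.
    - by rewrite -[X in (_ < X)%N]Sm [X in (_ < X)%N](cardsD1 v) vS.
    - rewrite [LHS](KP S) //; apply: cone_point_sub; first exact: subsetDl.
      by move=> u uS; rewrite !inE uS andbT negbK => /eqP ->.
  split=> //; first by rewrite /facet SD Sm eqxx.
  apply/forall_inP => v vS; apply/implyP => vX.
  rewrite -(@fan_inj S (fun u => -1 * k u) (K S)) //.
    by rewrite mulN1r oppr_gt0 -leNgt ltW ?kp.
  by rewrite -cone_pointZ -wE -KP // scaleN1r opprK.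
have uniq_enter X : X \in D -> exists S, forall S',
    [&& facet S', X \subset S' & [forall v in S', (v \notin X) ==> (0 < K S' v)]] = (S' == S).
  move=> XD; have [|S eS] := @enters_exists w X 1 gw XD ltr01.
    move=> e e0 _ j; rewrite center_shiftE addr_ge0 ?center_ge0 //.
    by rewrite mulr_ge0 ?ltW.
  exists S => S'; apply/entersP/eqP => [eS'|->//]; exact: enters_unique eS' eS.
transitivity (\sum_(X in D | G \subset X) \sum_(S | [&& facet S, X \subset S &
    [forall v in S, (v \notin X) ==> (0 < K S v)]]) (-1) ^+ #|X| : {poly R}).
  apply: eq_bigr => X /andP[XD _]; have [S SP] := uniq_enter X XD.
  by rewrite (eq_bigl _ _ SP) big_pred1_eq.
rewrite (exchange_big_dep (fun S => facet S && (G \subset S))) /=; last first.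
  by move=> X S /andP[_ GX] /and3P[-> XS _]; rewrite (subset_trans GX XS).
transitivity (\sum_(S | [&& facet S, G \subset S &
    [forall v in S, (v \notin G) ==> ~~ (0 < K S v)]]) (-1) ^+ m : {poly R}).
  rewrite [RHS]big_mkcond [LHS]big_mkcond; apply: eq_bigr => S _.
  rewrite andbA; case: ifPn => //= /andP[fS GS]; have [SD Sm] := facetP _ fS.
  pose B := G :|: [set v in S | ~~ (0 < K S v)].
  have BS : B \subset S.
    by rewrite subUset GS; apply/subsetP => v; rewrite inE => /andP[].
  rewrite (eq_bigl (fun X => (B \subset X) && (X \subset S))); last first.
    move=> X; rewrite fS /= subUset; have [XS|] := boolP (X \subset S);
      last by rewrite !andbF.
    rewrite (fan_sub SD XS) /= andbT; congr (_ && _).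
    apply/forall_inP/subsetP => [H v|H v vS].
      rewrite inE => /andP[vS]; apply: contraR => vX.
      by have /implyP := H v vS; apply.
    by apply/implyP; apply: contraR => Kv; apply: H; rewrite inE vS.
  rewrite (sum_interval _ BS) Sm.
  have -> : (B == S) = [forall v in S, (v \notin G) ==> ~~ (0 < K S v)].
    rewrite eqEsubset BS /=; apply/subsetP/forall_inP => H v vS.
      by have := H v vS; rewrite !inE vS /=; case: (v \in G).
    by have := H v vS; rewrite !inE vS /=; case: (v \in G).
  by case: ifP.
have [/eqP int|nint] := boolP (carrier G == setT).
  have c0 j : 0 < center G 0 j.
    have : j \in carrier G by rewrite int inE.
    by rewrite inE lt_def center_ge0 // andbT.
  (* Chosen so that d * w j <= center G j for all j. *)
  pose d := (1 + \sum_j w 0 j / center G 0 j)^-1.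
  have S0 : 0 < 1 + \sum_j w 0 j / center G 0 j.
    by rewrite ltr_pwDl // sumr_ge0 // => j _; rewrite divr_ge0 // ltW.
  have [||S eS] := @enters_exists (- w) G d (genericN gw) GD.
  - by rewrite invr_gt0.
  - move=> e e0 ed j; rewrite center_shiftE [(- w) _ _]mxE mulrN subr_ge0.
    rewrite -ler_pdivlMr // -[leRHS]invf_div; apply: le_trans ed _.
    rewrite lef_pV2 ?posrE ?divr_gt0 // (bigD1 j) //= addrCA lerDl.
    by rewrite addr_ge0 // sumr_ge0 // => i _; rewrite divr_ge0 // ltW.
  rewrite (big_pred1 S) // => S'; apply/entersNP/eqP => [eS'|->//].
  exact: enters_unique eS' eS.
rewrite big_pred0 // => S; apply/entersNP => eS.
have /subsetPn[j _] : ~~ (setT \subset carrier G) by rewrite subTset.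
rewrite inE negbK => /eqP cj.
have [d d0 /(_ d d0 (lexx d))[c cp E]] := enters_small eS.
have SD : S \in D by case: eS.
have := cone_point_ge0 j SD cp;
  rewrite -E center_shiftE cj [(- w) _ _]mxE add0r mulrN.
by rewrite oppr_ge0 leNgt mulr_gt0.
Qed.

(** The signed sum over J selects the X with full carrier.  By the Euler
    relation, that indicator is a signed sum over the faces above X;
    exchanging the two sums and applying the binomial theorem gives the right
    side. *)
Theorem fan_dehn_sommerville :
  \sum_(J : {set 'I_m}) (-1) ^+ (m - #|J|) *
     \sum_(X in D | carrier X \subset J) 'X^#|X| * (1 - 'X) ^+ (m - #|X|) =
  \sum_(X in D) ('X - 1) ^+ (m - #|X|) :> {poly R}.
Proof.
have signB n : (n <= m)%N -> (-1) ^+ (m - n) =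
  (-1) ^+ m * (-1) ^+ n :> {poly R}.
  by move=> nm; rewrite -[in RHS](subnK nm) exprD -mulrA -expr2 sqrr_sign mulr1.
transitivity (\sum_(X in D) 'X^#|X| * (1 - 'X) ^+ (m - #|X|) *+ (carrier X == setT) : {poly R}).
  under eq_bigr do rewrite mulr_sumr.
  rewrite (exchange_big_dep (mem D)) //=; last by move=> J X _ /andP[].
  apply: eq_bigr => X XD; rewrite -mulr_suml.
  rewrite (eq_bigl (fun J : {set 'I_m} =>
    (carrier X \subset J) && (J \subset [set: 'I_m]))); last first.
    by move=> J; rewrite XD subsetT andbT.
  rewrite (eq_bigr (fun J : {set 'I_m} => (-1) ^+ m * (-1) ^+ #|J|));
    last first.
    by move=> J _; rewrite signB // -[leqRHS]card_ord max_card.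
  rewrite -mulr_sumr sum_interval ?subsetT // cardsT card_ord.
  by rewrite mulrnAr -expr2 sqrr_sign mulrnAl mul1r.
transitivity (\sum_(X in D) \sum_(G : {set V} | G \subset X)
    (-1) ^+ (m - #|X|) * ('X^#|G| * (1 - 'X) ^+ (m - #|G|)) : {poly R});
      last first.
  apply: eq_bigr => X XD; rewrite -mulr_sumr.
  transitivity ((-1) ^+ (m - #|X|) * ((1 - 'X) ^+ (m - #|X|) *
     \sum_(G : {set V} | G \subset X) 'X^#|G| * (1 - 'X) ^+ (#|X| - #|G|)) :
       {poly R}).
    congr (_ * _); rewrite mulr_sumr; apply: eq_bigr => G GX.
    rewrite mulrCA -exprD addnBA ?subset_leq_card // subnK // ?fan_card //.
  rewrite sum_subsets addrCA subrr addr0 expr1n mulr1 -exprMn.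
  by rewrite mulN1r opprB.
rewrite (exchange_big_dep (mem D)) /=; last by move=> X G XD; exact: fan_sub.
apply: eq_bigr => G GD.
rewrite -mulr_suml (eq_bigr (fun X => (-1) ^+ m * (-1) ^+ #|X|)); last first.
  by move=> X /andP[XD _]; rewrite signB // fan_card.
rewrite -mulr_sumr fan_euler //.
by rewrite mulrnAr -expr2 sqrr_sign mulrnAl mul1r.
Qed.

End Fan.

(** * The fan of a triangulated simplex *)

Section TriangulationFan.
Variables (R : realType) (m : nat) (V : finType) (D : {set {set V}}).
Variable T : triangulation R (simplex m) D.

(** The point with barycentric coordinates x when these sum to one, and its
    linear extension otherwise. *)
Definition affine_image (x : 'rV[R]_m) : 'rV[R]_(ambient T) :=
  \sum_j x 0 j *: pt T j.
Definition total (x : 'rV[R]_m) : R := \sum_j x 0 j.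

Lemma affine_image_inj x y :
  total x = total y -> affine_image x = affine_image y -> x = y.
Proof.
move=> sE LE; have [AI _] := triangulation_pt T.
have {}AI := AI [set: 'I_m] (in_setT _).
have E0 : \sum_(j in [set: 'I_m]) (x 0 j - y 0 j) = 0.
  rewrite (eq_bigl xpredT) => [|j]; last by rewrite inE.
  by rewrite sumrB -/(total x) -/(total y) sE subrr.
have E1 : \sum_(j in [set: 'I_m]) (x 0 j - y 0 j) *: pt T j = 0.
  rewrite (eq_bigl xpredT) => [|j]; last by rewrite inE.
  under eq_bigr do rewrite scalerBl.
  by rewrite sumrB -/(affine_image x) -/(affine_image y) LE subrr.
apply/rowP => j; apply/eqP; rewrite -subr_eq0; apply/eqP.
exact: (AI _ E0 E1 j (in_setT j)).
Qed.

Definition barycentric (a : V -> 'rV[R]_m) := forall v, [set v] \in D ->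
  [/\ orthant (a v), total (a v) = 1 & affine_image (a v) = pt' T v].

Lemma barycentric_exists : exists a, barycentric a.
Proof.
suff /choice[a aP] v : exists x, [set v] \in D ->
    [/\ orthant x, total x = 1 & affine_image x = pt' T v] by exists a.
have [vD|] := boolP ([set v] \in D); last by exists 0.
have [_ sub] := triangulation_subdivides T.
have /sub [F _ [w [w0 w1 wE]]] : in_polyhedron D (pt' T) (pt' T v).
  exists [set v] => //; exists (fun => 1).
  by rewrite !big_set1 scale1r.
exists (\row_j if j \in F then w j else 0) => _; split.
- by move=> j; rewrite mxE; case: ifP => // /w0.
- by rewrite -w1 [RHS]big_mkcond; apply: eq_bigr => j _; rewrite mxE.
- rewrite wE [RHS]big_mkcond; apply: eq_bigr => j _; rewrite mxE.
  by case: ifP; rewrite ?scale0r.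
Qed.

Variable a : V -> 'rV[R]_m.
Hypothesis aP : barycentric a.

Let closed (G H : {set V}) : H \in D -> G \subset H -> G \in D.
Proof. by case: (triangulation_complex T) => _; apply. Qed.

Let vertexP (G : {set V}) v : G \in D -> v \in G ->
  [/\ orthant (a v), total (a v) = 1 & affine_image (a v) = pt' T v].
Proof. by move=> GD vG; apply: aP; apply: closed GD _; rewrite sub1set. Qed.

Lemma total_cone_point (G : {set V}) c : G \in D ->
  total (cone_point a G c) = \sum_(v in G) c v.
Proof.
move=> GD; rewrite /total; under eq_bigr do rewrite summxE.
rewrite exchange_big; apply: eq_bigr => v vG /=.
under eq_bigr do rewrite mxE.
by have [_ + _] := vertexP GD vG; rewrite -mulr_sumr /total => ->;
  rewrite mulr1.
Qed.

Lemma affine_image_cone_point (G : {set V}) c : G \in D ->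
  affine_image (cone_point a G c) = \sum_(v in G) c v *: pt' T v.
Proof.
move=> GD; rewrite /affine_image; under eq_bigr do rewrite summxE scaler_suml.
rewrite exchange_big; apply: eq_bigr => v vG /=.
have [_ _ <-] := vertexP GD vG; rewrite scaler_sumr.
by apply: eq_bigr => j _; rewrite mxE scalerA.
Qed.

Lemma totalZ k x : total (k *: x) = k * total x.
Proof. by rewrite /total mulr_sumr; apply: eq_bigr => j _; rewrite mxE. Qed.

Lemma affine_imageZ k x : affine_image (k *: x) = k *: affine_image x.
Proof. by rewrite /affine_image scaler_sumr; apply: eq_bigr => j _;
  rewrite mxE scalerA. Qed.

Lemma cone_point_total_gt0 (G : {set V}) v c : {in G, forall v, 0 < c v} ->
  v \in G ->
  0 < \sum_(v in G) c v :> R.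
Proof.
move=> cp vG; rewrite (bigD1 v) //= ltr_pwDl ?cp // sumr_ge0 // =>
  u /andP[uG _].
by rewrite ltW ?cp.
Qed.

(** After scaling to the simplex, the point lies in the geometric simplices
    of G and H, hence in that of their common face; its weights on G are unique
    and positive, so all vertices of G belong to H. *)
Lemma triangulation_unique (G H : {set V}) (c e : V -> R) : G \in D ->
  H \in D ->
  {in G, forall v, 0 < c v} -> {in H, forall v, 0 < e v} ->
  cone_point a G c = cone_point a H e -> G \subset H.
Proof.
move=> GD HD cp ep E; apply/subsetP => v vG; apply: contraT => vH.
pose s := \sum_(u in G) c u.
have s0 : 0 < s by apply: cone_point_total_gt0 vG.
have sE : s = \sum_(u in H) e u by rewrite /s -!total_cone_point // E.
pose y := s^-1 *: affine_image (cone_point a G c).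
have hull (X : {set V}) (r : V -> R) : X \in D -> {in X, forall u, 0 < r u} ->
    s = \sum_(u in X) r u -> affine_image (cone_point a G c) =
      affine_image (cone_point a X r) ->
    in_hull (pt' T) X y.
  move=> XD rp rs rE; exists (fun u => s^-1 * r u); split.
  - by move=> u uX; rewrite mulr_ge0 ?invr_ge0 ?ltW // rp.
  - by rewrite -mulr_sumr -rs mulVf // gt_eqF.
  - rewrite /y rE affine_image_cone_point // scaler_sumr.
    by apply: eq_bigr => u _; rewrite scalerA.
have [AI meet] := triangulation_pt' T.
have /(meet G H GD HD y) [r [r0 r1 rE]] :
  in_hull (pt' T) G y /\ in_hull (pt' T) H y.
  by split; [exact: (hull G c)|apply: (hull H e) => //; rewrite E].
pose r' u := if u \in H then r u else 0.
have r'E (U : lmodType R) (F : V -> U) : \sum_(u in G) r' u *: F u =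
  \sum_(u in G :&: H) r u *: F u.
  rewrite /r' [LHS]big_mkcond [RHS]big_mkcond; apply: eq_bigr => u _.
  by rewrite inE; case: (u \in G); case: (u \in H); rewrite ?scale0r.
have := AI G GD (fun u => s^-1 * c u - r' u).
move=> /(_ _ _ v vG); rewrite /r' (negPf vH) subr0 => H0.
have : s^-1 * c v = 0.
  apply: H0.
  - rewrite sumrB -mulr_sumr -/s mulVf ?gt_eqF // -r1.
    have := r'E R^o (fun => 1).
    under eq_bigr do rewrite [_ *: _]mulr1.
    under [RHS]eq_bigr do rewrite [_ *: _]mulr1.
    by move=> ->; rewrite subrr.
  - under eq_bigr do rewrite scalerBl -scalerA.
    by rewrite sumrB -scaler_sumr r'E -rE /y affine_image_cone_point // subrr.
by move=> /eqP; rewrite mulf_eq0 invr_eq0 !gt_eqF // cp.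
Qed.

(** Coning turns the covering of the simplex by the triangulation into
    the covering of the orthant, and the intersection property of a geometric
    complex into uniqueness of the cone containing a point. *)
Theorem triangulation_fan : orthant_fan D a.
Proof.
have [AI _] := triangulation_pt' T.
split.
- exact: triangulation_complex T.
- by move=> v vD; have [] := aP vD.
- move=> G c GD c0 v vG; apply: (AI G GD c) => //.
    by rewrite -total_cone_point // c0 /total big1 // => j _; rewrite mxE.
  by rewrite -affine_image_cone_point // c0 /affine_image big1 // => j _;
    rewrite mxE scale0r.
- move=> x x0; have : 0 <= total x by apply: sumr_ge0 => j _; exact: x0.
  rewrite le0r => /orP[/eqP s0|s0].
    exists set0, (fun => 0); split; first by case: (triangulation_complex T).
      by move=> v; rewrite inE.
    rewrite /cone_point big_set0; apply/rowP => j; rewrite mxE; move: s0 =>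
      /eqP.
    by rewrite psumr_eq0 // => /allP /(_ j (mem_index_enum _)) /eqP.
  have [_ sub] := triangulation_subdivides T.
  have /sub [G GD [w [w0 w1 wE]]] : in_polyhedron (simplex m) (pt T)
    ((total x)^-1 *: affine_image x).
    exists [set: 'I_m]; first by rewrite inE.
    exists (fun j => (total x)^-1 * x 0 j); split.
    + by move=> j _; apply: mulr_ge0; [rewrite invr_ge0 ltW|exact: x0].
    + by rewrite (eq_bigl xpredT) => [|j];
      rewrite ?inE // -mulr_sumr mulVf // gt_eqF.
    + rewrite (eq_bigl xpredT) => [|j]; rewrite ?inE // scaler_sumr.
      by apply: eq_bigr => j _; rewrite scalerA.
  pose G' := [set v in G | 0 < w v].
  have G'G : G' \subset G by apply/subsetP => v; rewrite inE => /andP[].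
  exists G', (fun v => total x * w v); split; first exact: closed G'G.
    by move=> v; rewrite inE => /andP[_ wv]; rewrite mulr_gt0.
  rewrite -cone_pointZ -(@cone_point_sub _ _ _ _ G' G) //; last first.
    move=> v vG; rewrite inE vG /= -leNgt => wv.
    by apply/eqP; rewrite eq_le wv w0.
  apply: affine_image_inj; first by rewrite totalZ total_cone_point // w1 mulr1.
  by rewrite affine_imageZ affine_image_cone_point // -wE scalerA mulfV ?scale1r ?gt_eqF.
- move=> G H c e GD HD cp ep E; apply/eqP; rewrite eqEsubset.
  by rewrite (triangulation_unique GD HD cp ep E)
    (triangulation_unique HD GD ep cp).
Qed.

(** A simplex lies in a face if and only if its vertices do, and a vertex does
    when its barycentric coordinates outside the face vanish. *)
Lemma restriction_carrier (F : {set 'I_m}) :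
  restriction T F = [set G in D | carrier a G \subset F].
Proof.
apply/setP => G; rewrite !inE; have [GD|] := boolP (G \in D) => //=.
rewrite (carrier_subset triangulation_fan) //.
apply/asboolP/'forall_in_forallP => [H v vG j|H x [w [w0 w1 ->]]].
  apply/implyP => jF; have [av0 av1 avE] := vertexP GD vG.
  have /H [r [_ r1 rE]] : in_hull (pt' T) G (pt' T v).
    exists (fun u => (u == v)%:R); split; first by move=> u _; exact: ler0n.
      rewrite (bigD1 v) //= eqxx big1 ?addr0 // => u /andP[_ /negPf ->] //.
    rewrite (bigD1 v) //= eqxx scale1r big1 ?addr0 // => u /andP[_ /negPf ->].
    by rewrite scale0r.
  suff -> : a v = \row_j if j \in F then r j else 0 by rewrite mxE (negPf jF).
  apply: affine_image_inj.
    by rewrite av1 -r1 [LHS]big_mkcond; apply: eq_bigr => i _; rewrite mxE.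
  rewrite avE rE [LHS]big_mkcond; apply: eq_bigr => i _; rewrite mxE.
  by case: ifP; rewrite ?scale0r.
have out j : j \notin F -> cone_point a G w 0 j = 0.
  move=> jF; rewrite summxE big1 // => v vG; rewrite mxE.
  by have /implyP/(_ jF)/eqP -> := H v vG j; rewrite mulr0.
exists (fun j => cone_point a G w 0 j); split.
- move=> j _; rewrite summxE sumr_ge0 // => v vG; rewrite mxE mulr_ge0 ?w0 //.
  by have [+ _ _] := vertexP GD vG; apply.
- rewrite -w1 -total_cone_point // [LHS]big_mkcond; apply: eq_bigr => j _.
  by case: ifPn => // /out ->.
- rewrite -affine_image_cone_point // [RHS]big_mkcond; apply: eq_bigr => j _.
  by case: ifPn => // /out ->; rewrite scale0r.
Qed.

End TriangulationFan.

(** * The polynomials of an f-triangle *)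

Section UniformPolynomials.
Variables (R : realType) (f : nat -> nat -> nat).
Implicit Types (n m k : nat).

Local Notation h := (hpoly_simplex R f).
Local Notation p := (ppoly R f).

Lemma hpoly_simplexE n : h n = \sum_(i < n.+1)
  (f i n)%:R *: ('X^i * (1 - 'X) ^+ (n - i)).
Proof.
apply: eq_bigr => i _; congr (_ *: _).
rewrite coef_sum (bigD1 i) //= big1 ?addr0 ?coefZ ?coefXn ?eqxx ?mulr1 //.
by move=> j /negPf ij; rewrite coefZ coefXn (inj_eq val_inj) eq_sym ij mulr0.
Qed.

Lemma size_hpoly_simplex n : (size (h n) <= n.+1)%N.
Proof.
rewrite hpoly_simplexE; apply: (leq_trans (size_sum _ _ _));
  apply/bigmax_leqP => i _.
apply: (leq_trans (size_scale_leq _ _)); apply: (leq_trans (size_polyMleq _ _)).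
rewrite size_polyXn /=; apply: leq_trans (_ : i + (n - i).+1 <= _)%N;
  last first.
  by rewrite addnS subnKC // -ltnS.
rewrite leq_add2l; apply: (leq_trans (size_poly_exp_leq _ _)).
have : (size ((1 - 'X)%R : {poly R}) <= 2)%N.
  apply: (leq_trans (size_polyD _ _));
    rewrite size_poly1 size_opp size_polyX //.
by move=> sz; rewrite ltnS -[leqRHS]mul1n leq_mul2r; apply/orP; right; lia.
Qed.

(** The functional that replaces the power t^j by the polynomial h_j; the
    sums that define the other polynomials become its values at products. *)
Definition hfunctional (N : nat) (Q : {poly {poly R}}) : {poly R} :=
  \sum_(j < N) Q`_j * h j.

Lemma hfunctionalD N P Q : hfunctional N (P + Q) =
  hfunctional N P + hfunctional N Q.
Proof. by rewrite -big_split; apply: eq_bigr => j _; rewrite coefD mulrDl. Qed.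

Lemma hfunctionalZ N c Q : hfunctional N (c *: Q) = c * hfunctional N Q.
Proof. by rewrite mulr_sumr; apply: eq_bigr => j _; rewrite coefZ mulrA. Qed.

Lemma hfunctional_sum N (I : Type) (r : seq I) (P : pred I)
  (F : I -> {poly {poly R}}) :
  hfunctional N (\sum_(i <- r | P i) F i) =
    \sum_(i <- r | P i) hfunctional N (F i).
Proof.
elim/big_rec2: _ => [|i x y _ <-]; last exact: hfunctionalD.
by rewrite /hfunctional big1 // => j _; rewrite coef0 mul0r.
Qed.

Lemma coef_addC_exp (c : {poly R}) n i : ((c%:P + 'X) ^+ n)`_i =
  c ^+ (n - i) *+ 'C(n, i).
Proof.
rewrite exprDn coef_sum.
have [ilt|nle] := ltnP i n.+1; last first.
  rewrite bin_small // big1 // => j _.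
  rewrite coefMn -rmorphXn coefCM coefXn (gtn_eqF (leq_trans (ltn_ord j) nle)).
  by rewrite mulr0 mul0rn.
rewrite (bigD1 (Ordinal ilt)) //= big1 ?addr0.
  by rewrite coefMn -rmorphXn coefCM coefXn eqxx mulr1.
move=> j; rewrite -val_eqE /= => /negPf ij;
  rewrite coefMn -rmorphXn coefCM coefXn eq_sym ij.
by rewrite mulr0 mul0rn.
Qed.

Lemma ellpolyE N r : (r < N)%N -> ellpoly R f r = hfunctional N (('X - 1) ^+ r).
Proof.
move=> rN; rewrite /hfunctional /ellpoly (big_ord_widen_cond N xpredT
  (fun k => (-1) ^+ (r - k) * 'C(r, k)%:R * h k)) //= big_mkcond /=.
apply: eq_bigr => k _; have -> : 'X - 1 =
  (-1)%:P + 'X :> {poly {poly R}} by rewrite addrC polyCN.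
rewrite coef_addC_exp mulr_natr; case: ifPn => // nle.
by rewrite bin_small ?mulr0n ?mul0r // ltnNge.
Qed.

(** The local polynomial of index r is the value at (t - 1)^r, and the
    coefficients in the definition of p_{n,k} are those of
    (1 + t)^(n - k) (x + t)^k; substituting t - 1 for t gives the product. *)
Lemma ppolyE N n k : (n < N)%N -> (k <= n)%N ->
  p n k = hfunctional N ('X ^+ (n - k) * ('X + ('X - 1)%:P) ^+ k).
Proof.
move=> nN kn.
pose Q : {poly {poly R}} := (1%:P + 'X) ^+ (n - k) * ('X%:P + 'X) ^+ k.
have sQ : (size Q <= n.+1)%N.
  apply: (leq_trans (size_polyMleq _ _)).
  have szE (c : {poly R}) j :
    (size ((c%:P + 'X : {poly {poly R}}) ^+ j) <= j.+1)%N.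
    apply: (leq_trans (size_poly_exp_leq _ _)).
    by rewrite addrC size_XaddC mul1n.
  have := szE 1 (n - k)%N; have := szE 'X k; set a := size _; set b :=
    size _; lia.
have QE : Q \Po ('X - 1) = 'X ^+ (n - k) * ('X + ('X - 1)%:P) ^+ k.
  rewrite /Q comp_polyM !rmorphXn /= !comp_polyD !comp_polyC comp_polyX.
  congr (_ ^+ _ * _ ^+ _).
    by rewrite addrC subrK.
  by rewrite polyCB; ring.
rewrite -QE comp_polyE hfunctional_sum /ppoly.
transitivity (\sum_(r < n.+1) ellpoly R f r * Q`_r).
  apply: eq_bigr => r _; congr (_ * _); rewrite coefM; apply: eq_bigr => i _.
  have ir : (i <= r)%N by rewrite -ltnS.
  rewrite !coef_addC_exp expr1n subnBA // scaler_nat.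
  by rewrite mulr_natl -mulrnA mulnC.
rewrite (big_ord_widen_cond n.+1 xpredT (fun i =>
  hfunctional N (Q`_i *: ('X - 1) ^+ i))) //=.
rewrite [RHS]big_mkcond /=; apply: eq_bigr => r _.
case: ifPn => [_|]; last by rewrite -leqNgt => /(nth_default 0) ->;
  rewrite mulr0.
by rewrite hfunctionalZ mulrC -ellpolyE // (leq_trans (ltn_ord r)).
Qed.

(** The products for (n+1, k+1) and (n+1, k) differ by the factors
    t + x - 1 and t. *)
Lemma ppoly_rec n k : (k <= n)%N -> p n.+1 k.+1 = p n.+1 k + ('X - 1) * p n k.
Proof.
move=> kn; rewrite !(@ppolyE n.+2) ?ltnS // ?(leqW kn) //.
rewrite -hfunctionalZ -hfunctionalD; congr hfunctional.
by rewrite subSS subSn // !exprS -mul_polyC; ring.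
Qed.

Lemma ppolyn0 n : p n 0%N = h n.
Proof.
rewrite (@ppolyE n.+1) // subn0 expr0 mulr1 /hfunctional (bigD1 ord_max) //= big1 ?addr0.
  by rewrite coefXn eqxx mul1r.
by move=> j; rewrite -val_eqE /= => /negPf jn; rewrite coefXn jn mul0r.
Qed.

Lemma ppolynn n : p n n = \sum_(j < n.+1) ('X - 1) ^+ (n - j) *+ 'C(n, j) * h j.
Proof.
rewrite (@ppolyE n.+1) // subnn expr0 mul1r /hfunctional addrC.
by apply: eq_bigr => j _; rewrite coef_addC_exp.
Qed.

Lemma ppoly_boundary n k : (k <= n.+1)%N ->
  p n.+1 k = h n.+1 + ('X - 1) * \sum_(i < k) p n i.
Proof.
elim: k => [|k IHk] kn; first by rewrite big_ord0 mulr0 addr0 ppolyn0.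
by rewrite ppoly_rec // IHk ?(ltnW kn) // big_ord_recr /= mulrDr addrA.
Qed.

(** After multiplication by 1 - x, both sides are the binomial
    expansion of (x + (1 - x))^(n+1) without its last term. *)
Lemma hpoly_boundary_simplex n : hpoly R (simplex_boundary n.+1) =
  \sum_(i < n.+1) 'X^i
  /\ rank_complex (simplex_boundary n.+1) = n.
Proof.
have rk : rank_complex (simplex_boundary n.+1) = n.
  apply/eqP; rewrite eqn_leq; apply/andP; split.
    apply/bigmax_leqP => F; rewrite !inE => FT.
    rewrite -ltnS -[X in (_ < X)%N]card_ord -cardsT; apply: proper_card.
    by rewrite properEneq FT subsetT.
  pose A := [set: 'I_n.+1] :\ ord0.
  have An : #|A| = n.
    by have := cardsD1 ord0 [set: 'I_n.+1];
      rewrite cardsT card_ord inE add1n => -[].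
  have AD : A \in simplex_boundary n.+1.
    by rewrite !inE; apply/eqP => /setP /(_ ord0); rewrite !inE eqxx.
  rewrite -[X in (X <= _)%N]An /rank_complex.
  exact: (@leq_bigmax_cond _ _ (fun F : {set 'I_n.+1} => #|F|) A AD).
split=> //; rewrite /hpoly rk.
have coefE (i : 'I_n.+1) : (fpoly R (simplex_boundary n.+1))`_i =
  'C(n.+1, i)%:R.
  rewrite /fpoly rk coef_sum (bigD1 i) //= big1 ?addr0; last first.
    by move=> j /negPf ij;
      rewrite coefZ coefXn (inj_eq val_inj) eq_sym ij mulr0.
  rewrite coefZ coefXn eqxx mulr1 /nfaces; congr (_%:R).
  have := card_draws 'I_n.+1 i; rewrite card_ord => <-.
  apply: eq_card => F; rewrite !inE andb_idl // => /eqP Fi; apply/eqP => FT.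
  by have := ltn_ord i; rewrite -[X in (X < _)%N]Fi FT cardsT card_ord ltnn.
have X1 : 1 - 'X != 0 :> {poly R}.
  by rewrite -oppr_eq0 opprB polyXsubC_eq0.
apply: (mulfI X1); rewrite [RHS](_ : _ = 1 - 'X^(n.+1)); last first.
  by rewrite -opprB mulNr -subrX1 opprB.
have := exprDn (1 - 'X : {poly R}) 'X n.+1;
  rewrite subrK expr1n big_ord_recr /=.
rewrite subnn expr0 mul1r binn mulr1n.
move=> /(congr1 (fun q => q - 'X^(n.+1))); rewrite addrK => ->.
rewrite /f_to_h mulr_sumr; apply: eq_bigr => i _.
have le_in : (i <= n)%N by rewrite -ltnS.
by rewrite coefE -scalerAr mulrCA -exprS -subSn // mulrC scaler_nat.
Qed.

Lemma hpoly_uniform_boundary n :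
  hpoly_uniform R f (simplex_boundary n.+1) = \sum_(k < n.+1) p n k.
Proof.
have [hE rk] := hpoly_boundary_simplex n.
rewrite /hpoly_uniform rk; apply: eq_bigr => k _.
rewrite hE coef_sum (bigD1 k) //= big1 ?addr0.
  by rewrite coefXn eqxx scale1r.
by move=> j /negPf jk; rewrite coefXn (inj_eq val_inj) eq_sym jk.
Qed.

Lemma size_ppoly n k : (k <= n)%N -> (size (p n k) <= n.+1)%N.
Proof.
elim: n k => [|n IHn] k; first by rewrite leqn0 => /eqP ->;
  rewrite ppolyn0 size_hpoly_simplex.
elim: k => [|k IHk] kn; first by rewrite ppolyn0 size_hpoly_simplex.
rewrite ppoly_rec //; apply: (leq_trans (size_polyD _ _));
  rewrite geq_max IHk ?(ltnW kn) //=.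
apply: (leq_trans (size_polyMleq _ _)); rewrite size_XsubC add2n /= ltnS.
by apply: IHn.
Qed.

End UniformPolynomials.

(** * The symmetry of the polynomials of a feasible f-triangle *)

Section DehnSommerville.
Variables (R : realType) (d : option nat) (f : nat -> nat -> nat).
Hypothesis feas : feasible R d f.

Local Notation h := (hpoly_simplex R f).

(** The number of faces with a given size and carrier inside J depends
    only on |J|, so grouping the Dehn-Sommerville relation of the fan by |J|
    yields the binomial sum that expresses p_{m,m}. *)
Theorem hpoly_simplex_dehn_sommerville m : le_size m d ->
  reversal m (h m) = ppoly R f m m.
Proof.
move=> md; have [V [D [T unif]]] := feas md.
have [a aP] := barycentric_exists T.
have F := triangulation_fan aP.
have DS := fan_dehn_sommerville F.
have count (J : {set 'I_m}) (g : nat -> {poly R}) :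
    \sum_(X in D | carrier a X \subset J) g #|X| = \sum_(i < #|J|.+1)
      (f i #|J|)%:R *: g i.
  rewrite (partition_big (fun X : {set V} => inord #|X| :
    'I_#|J|.+1) xpredT) //=.
  have Jd : le_size #|J| d.
    case: (d) md => //= d' md; apply: leq_trans md.
    by rewrite -[leqRHS]card_ord max_card.
  apply: eq_bigr => i _; rewrite -(unif i #|J| _ Jd J) ?inE -1?ltnS //.
  rewrite /nfaces (restriction_carrier aP).
  have inordE X : X \in D -> carrier a X \subset J -> (inord #|X| == i) =
    (#|X| == i).
    move=> XD XJ; rewrite -val_eqE /= inordK // ltnS.
    apply: (fan_card_supp F XD) => v vX j jJ.
    have := carrier_subset F J XD; rewrite XJ => /esym /forall_inP /(_ v vX).
    by move=> /forallP /(_ j) /implyP /(_ jJ) /eqP.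
  rewrite (eq_bigr (fun=> g i)); last first.
    by move=> X /andP[/andP[XD XJ]]; rewrite inordE // => /eqP ->.
  rewrite scaler_nat -sumr_const; apply: eq_bigl => X; rewrite !inE.
  by case XD: (X \in D) => //=; case XJ: (_ \subset _) => //=; rewrite inordE.
rewrite ppolynn.
transitivity (\sum_(X in D) ('X - 1) ^+ (m - #|X|) : {poly R}).
  apply: reversal_eq; first exact: size_hpoly_simplex.
  move=> x x0; have := count [set: 'I_m] (fun i => ('X - 1) ^+ (m - i)).
  rewrite (eq_bigl (mem D)) => [->|X]; last by rewrite subsetT andbT.
  rewrite cardsT card_ord hpoly_simplexE !horner_sum mulr_sumr;
    apply: eq_bigr => i _.
  have im : (i <= m)%N by rewrite -ltnS.
  rewrite !hornerZ hornerM !horner_exp hornerXsubC hornerX hornerD hornerN hornerX hornerC mulrCA; congr (_ * _).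
  have -> : x ^+ m = x ^+ (m - i) * x ^+ i by rewrite -exprD subnK.
  rewrite -mulrA [x ^+ i * _]mulrA -exprMn mulfV // expr1n mul1r.
  by rewrite -exprMn mulrBr mulr1 mulfV.
rewrite -DS.
rewrite (partition_big (fun J : {set 'I_m} => inord #|J| : 'I_m.+1) xpredT) //=.
apply: eq_bigr => k _.
have km : (k <= m)%N by rewrite -ltnS.
have cardJ (J : {set 'I_m}) : (inord #|J| == k) = (#|J| == k).
  by rewrite -val_eqE /= inordK // ltnS -[leqRHS]card_ord max_card.
rewrite (eq_bigr (fun=> ('X - 1) ^+ (m - k) * h k)); last first.
  move=> J; rewrite cardJ => /eqP Jk.
  rewrite (count J (fun i => 'X^i * (1 - 'X) ^+ (m - i))) Jk hpoly_simplexE.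
  have -> : ('X - 1) ^+ (m - k) =
    (-1) ^+ (m - k) * (1 - 'X) ^+ (m - k) :> {poly R}.
    by rewrite -exprMn mulN1r opprB.
  rewrite -mulrA; congr (_ * _); rewrite mulr_sumr.
  apply: eq_bigr => i _; have ik : (i <= k)%N by rewrite -ltnS.
  rewrite -scalerAr; congr (_ *: _); rewrite mulrCA -exprD;
    congr (_ * _ ^+ _); lia.
rewrite (eq_bigl (fun J => J \in [set J : {set 'I_m} | #|J| == k])) => [|J];
  last by rewrite inE cardJ.
rewrite sumr_const mulrnAl; congr (_ *+ _).
by rewrite card_draws card_ord.
Qed.

Lemma feasible_f0 m : le_size m d -> f 0 m = 1%N.
Proof.
move=> md; have [V [D [T unif]]] := feas md.
have := unif 0%N m (leq0n m) md [set: 'I_m]; rewrite inE cardsT card_ord =>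
  <- //.
rewrite /nfaces; apply/eqP/cards1P; exists set0; apply/setP => X; rewrite !inE.
rewrite cards_eq0 andb_idl // => /eqP ->; apply/andP; split.
  by case: (triangulation_complex T).
apply/asboolP => x [w [_ ]]; rewrite big_set0 => /eqP.
by rewrite eq_sym oner_eq0.
Qed.

Lemma hpoly_simplex0 m : le_size m d -> (h m)`_0 = 1.
Proof.
move=> md; rewrite hpoly_simplexE -horner_coef0 horner_sum big_ord_recl big1 ?addr0.
  by rewrite /= feasible_f0 // scale1r expr0 mul1r subn0 horner_exp !hornerE subr0 expr1n.
by move=> i _; rewrite !hornerE /= expr0n /= !(mul0r, mulr0).
Qed.

End DehnSommerville.

(** * Real-rooted polynomials with nonnegative coefficients *)

Section Nonneg.
Variable R : realType.
Implicit Types (p q f g b : {poly R}) (s t : seq R).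

Lemma nonneg_coefs0 : nonneg_coefs (0 : {poly R}).
Proof. by move=> i; rewrite coef0. Qed.

Lemma nonneg_coefsD p q : nonneg_coefs p -> nonneg_coefs q ->
  nonneg_coefs (p + q).
Proof. by move=> p0 q0 i; rewrite coefD addr_ge0. Qed.

Lemma nonneg_coefs_sum (I : Type) (r : seq I) (P : pred I) (F : I -> {poly R}) :
  (forall i, P i -> nonneg_coefs (F i)) ->
    nonneg_coefs (\sum_(i <- r | P i) F i).
Proof.
by move=> H; elim/big_rec: _ => [|i p Pi];
  [exact: nonneg_coefs0|apply: nonneg_coefsD (H i Pi)].
Qed.

Lemma nonneg_coefsXM p : nonneg_coefs p -> nonneg_coefs ('X * p).
Proof. by move=> p0 i; rewrite coefXM; case: eqP. Qed.

Lemma nonneg_horner_ge0 p x : nonneg_coefs p -> 0 <= x -> 0 <= p.[x].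
Proof.
move=> p0 x0; rewrite horner_coef sumr_ge0 // => i _.
by rewrite mulr_ge0 ?exprn_ge0.
Qed.

Lemma nonneg_lead_coef p : nonneg_coefs p -> p != 0 -> 0 < lead_coef p.
Proof. by move=> p0 pN0; rewrite lt_def lead_coef_eq0 pN0 /lead_coef p0. Qed.

Lemma nonneg_root p x : nonneg_coefs p -> p != 0 -> root p x -> x <= 0.
Proof.
move=> p0 pN0; rewrite leNgt => /rootP px; apply/negP => x0; move: px;
  apply/eqP.
have sz : ((size p).-1 < size p)%N by rewrite prednK // size_poly_gt0.
rewrite gt_eqF // horner_coef (bigD1 (Ordinal sz)) //= ltr_pwDl ?sumr_ge0 //.
  by rewrite mulr_gt0 ?exprn_gt0 // nonneg_lead_coef.
by move=> i _; rewrite mulr_ge0 ?exprn_ge0 // ltW.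
Qed.

Definition nonneg_rr p := real_rooted p /\ nonneg_coefs p.

Definition roots_of p s :=
  [/\ sorted >=%R s, p =
    lead_coef p *: rprod s, 0 < lead_coef p & all (fun a => a <= 0) s].

Lemma root_seq_roots_of p s : nonneg_coefs p -> p != 0 -> root_seq p s ->
  roots_of p s.
Proof.
move=> p0 pN0 [ss pE]; have lc := nonneg_lead_coef p0 pN0.
split=> //; apply/allP => a sa; apply: (nonneg_root p0 pN0).
by rewrite pE rootZ ?gt_eqF // root_prod_XsubC.
Qed.

Lemma nonneg_rr_roots p : nonneg_rr p -> p != 0 -> exists s, roots_of p s.
Proof.
move=> [rp p0] pN0; have [s [ss pE]] := real_rooted_split pN0 rp.
by exists s; apply: root_seq_roots_of.
Qed.

Lemma roots_ofXM p s : roots_of p s -> roots_of ('X * p) (0 :: s).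
Proof.
move=> [ss pE lp sa]; have lX : lead_coef ('X * p) = lead_coef p.
  by rewrite lead_coefM lead_coefX mul1r.
split; rewrite ?lX //=; last by rewrite lexx.
  by rewrite path_min_sorted.
by rewrite rprod_cons subr0 scalerAr -pE.
Qed.

(** The bridge between certificates and root sequences. *)
Lemma roots_of_bezout_pos f g s t : roots_of f s -> roots_of g t ->
  bezout_pos f g <-> count_interlace s t.
Proof.
move=> [ss fE lf _] [st gE lg _]; split=> [B|H].
  apply: bezout_pos_count_interlace; have :=
    bezout_pos_scale_l (ltW (_ : 0 < (lead_coef f)^-1))
    (bezout_pos_scale_r (ltW (_ : 0 < (lead_coef g)^-1)) B).
  rewrite !invr_gt0 lf lg {2}fE {2}gE !scalerA !mulVf ?gt_eqF // !scale1r;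
    exact.
rewrite fE gE; apply: bezout_pos_scale_l; first exact: ltW.
apply: bezout_pos_scale_r; first exact: ltW.
by have [us [_ H']] := count_interlace_bezout_cert ss st H; exists us.
Qed.

(** All roots are at most 0, and multiplying f by x adds the root 0. *)
Lemma bezout_pos_flip f g : nonneg_rr f -> nonneg_rr g ->
  bezout_pos f g <-> bezout_pos g ('X * f).
Proof.
move=> nf ng; have [->|f0] := eqVneq f 0.
  by rewrite mulr0; split=> _; [exact: bezout_pos_0r|exact: bezout_pos_0l].
have [->|g0] := eqVneq g 0; first by split=> _;
  [exact: bezout_pos_0l|exact: bezout_pos_0r].
have [s sf] := nonneg_rr_roots nf f0; have [t tg] := nonneg_rr_roots ng g0.
rewrite (roots_of_bezout_pos sf tg) (roots_of_bezout_pos tg (roots_ofXM sf)).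
by case: sf => _ _ _ sf; case: tg => _ _ _ tg; rewrite flip_count_interlace.
Qed.

(** The roots of f lie between those of f0 and those of f1. *)
Lemma bezout_pos_between f0 f f1 g : nonneg_rr f0 -> nonneg_rr f ->
  nonneg_rr f1 -> nonneg_rr g ->
  f0 != 0 -> f != 0 -> f1 != 0 ->
  bezout_pos f0 f -> bezout_pos f f1 -> bezout_pos f0 g -> bezout_pos f1 g ->
    bezout_pos f g.
Proof.
move=> n0 n n1 ng z0 z z1; have [->|g0] := eqVneq g 0; first by move=> *;
  exact: bezout_pos_0r.
have [s0 r0] := nonneg_rr_roots n0 z0; have [s r] := nonneg_rr_roots n z.
have [s1 r1] := nonneg_rr_roots n1 z1; have [t rt] := nonneg_rr_roots ng g0.
rewrite (roots_of_bezout_pos r0 r) (roots_of_bezout_pos r r1)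
  (roots_of_bezout_pos r0 rt).
rewrite (roots_of_bezout_pos r1 rt) (roots_of_bezout_pos r rt) => H1 H2 H3 H4 x.
by move: (H1 x) (H2 x) (H3 x) (H4 x); lia.
Qed.

Lemma bezout_pos_interlaces f g : nonneg_rr f -> nonneg_rr g ->
  bezout_pos f g -> interlaces f g.
Proof.
move=> nf ng B; split; [by case: nf|by case: ng|].
have [->|f0] := eqVneq f 0; first by left.
have [->|g0] := eqVneq g 0; first by right; left.
have [s rs] := nonneg_rr_roots nf f0; have [t rt] := nonneg_rr_roots ng g0.
have H := (roots_of_bezout_pos rs rt).1 B; case: rs => ss fE _ _; case: rt =>
  st gE _ _.
have [sz H1 H2] := (count_interlaceP ss st).1 H.
by right; right; exists s, t.
Qed.

Lemma interlaces_bezout_cert f g : nonneg_coefs f -> nonneg_coefs g ->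
  f != 0 -> g != 0 ->
  interlaces f g ->
  exists us, {in us, forall u :
    {poly R}, (size u <= (size g).-1)%N} /\ bezout_cert us f g.
Proof.
move=> nf ng f0 g0 [_ _ [/eqP|[/eqP|[s [t [rs rt sz H1 H2]]]]]];
  rewrite ?(negPf f0) ?(negPf g0) //.
have [ss fE lf _] := root_seq_roots_of nf f0 rs; have [st gE lg _] :=
  root_seq_roots_of ng g0 rt.
have H : count_interlace s t by apply/(count_interlaceP ss st).
have [us [szu H']] := count_interlace_bezout_cert ss st H.
have {}H' := bezout_cert_scale (ltW lg) H'.
exists [seq Num.sqrt (lead_coef f) *: u | u <- [seq Num.sqrt (lead_coef g) *: u | u <- us]]; split.
  move=> _ /mapP[_ /mapP[u us_u ->] ->]; rewrite scalerA.
  apply: (leq_trans (size_scale_leq _ _)); rewrite gE size_scale ?gt_eqF //.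
  by rewrite /rprod size_prod_XsubC /= szu.
have := @bezout_cert_scale _ _ (lead_coef g *: rprod t) (- rprod s) _ (ltW lf).
move=> /(_ [seq Num.sqrt (lead_coef g) *: u | u <- us]) HH x y.
rewrite -HH; first by rewrite {1 2}gE {1 2}fE !hornerZ !hornerN; ring.
by move=> {}x {}y; rewrite -H' !hornerN; ring.
Qed.

Lemma bezout_pos_nonneg_rr f g : f != 0 -> nonneg_rr f -> bezout_pos f g ->
  nonneg_coefs g -> nonneg_rr g.
Proof. by move=> f0 [rf _] B ng; split=> //;
  exact: bezout_pos_real_rooted B. Qed.

Lemma nonneg_rr0 : nonneg_rr 0.
Proof. by split; [left|exact: nonneg_coefs0]. Qed.

End Nonneg.

(** * From one interlacing sequence to the next *)

Section Step.
Variables (R : realType) (m : nat) (P : nat -> {poly R}) (q : {poly R}).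

(** Positivity at 1 keeps the members nonzero, and it passes to sums and to
    multiples by x. *)
Definition interlacing_sequence (N : nat) (Q : nat -> {poly R}) :=
  [/\ forall i, (i <= N)%N -> nonneg_rr (Q i),
      forall i, (i <= N)%N -> 0 < (Q i).[1] &
      forall i j, (i <= j)%N -> (j <= N)%N -> bezout_pos (Q i) (Q j)].

(** The value at k of the map that produces p_{m+1,k} from the p_{m,i}. *)
Definition next_row k : {poly R} :=
  'X * \sum_(i < m.+1 | (i < k)%N) P i + \sum_(i < m.+1 | ~~ (i < k)%N) P i + q.

Hypothesis HP : interlacing_sequence m P.
Hypothesis Hq : nonneg_rr q.
Hypothesis HPq : forall i, (i <= m)%N -> bezout_pos (P i) q.

Lemma next_row0 : next_row 0 = \sum_(i < m.+1) P i + q.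
Proof. by rewrite /next_row big_pred0 // mulr0 add0r. Qed.

(** Split the indices into those below k, those from k to l - 1 and the
    rest, with sums A, B and C.  Then next_row k = x A + B + C + q, and
    next_row l differs from it by x B - B.  So it is enough that B interlaces
    x A, B, C and q, and that x A, B, C and q interlace x B, which follows
    termwise, the pairs B, B and B, x B excepted. *)
Lemma bezout_pos_next_row k l : (k <= l)%N -> bezout_pos (next_row k)
  (next_row l).
Proof.
move=> kl; have [nP _ PP] := HP.
pose A : {poly R} := \sum_(i < m.+1 | (i < k)%N) P i.
pose B : {poly R} := \sum_(i < m.+1 | ~~ (i < k)%N && (i < l)%N) P i.
pose C : {poly R} := \sum_(i < m.+1 | ~~ (i < l)%N) P i.
have rowkE : next_row k = 'X * A + (B + C) + q.
  rewrite /next_row -/A; congr (_ + _ + _);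
    rewrite (bigID (fun i : 'I__ => (i < l)%N)) /=.
  by congr (_ + _); apply: eq_bigl => i; lia.
have rowlE : next_row l = next_row k + ('X * B - B).
  rewrite rowkE /next_row -/C (bigID (fun i : 'I__ => (i < k)%N)) /=.
  rewrite (eq_bigl (fun i : 'I_m.+1 => (i < k)%N)) => [|i]; last by lia.
  rewrite [X in _ * (_ + X)](eq_bigl (fun i : 'I_m.+1 =>
    ~~ (i < k)%N && (i < l)%N)) => [|i]; last by lia.
  by rewrite -/A -/B; ring.
have le_m (i : 'I_m.+1) : (i <= m)%N by rewrite -ltnS.
have flip i j : (i <= j)%N -> (j <= m)%N -> bezout_pos (P j) ('X * P i).
  move=> ij jm; have ni := nP i (leq_trans ij jm).
  by apply/(bezout_pos_flip ni (nP j jm)); exact: PP.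
have XB : 'X * B =
  \sum_(i < m.+1 | ~~ (i < k)%N && (i < l)%N) 'X * P i by rewrite mulr_sumr.
have XA : 'X * A = \sum_(i < m.+1 | (i < k)%N) 'X * P i by rewrite mulr_sumr.
rewrite rowlE; apply: bezout_pos_add_r; first exact: bezout_pos_refl.
rewrite rowkE; apply: bezout_pos_add_r;
  last apply: (proj1 (bezout_pos_swapN _ _)).
- apply: bezout_pos_add_l; first apply: bezout_pos_add_l; last 1 first.
  + by rewrite XB; apply: bezout_pos_sum_r => i _;
    apply/(bezout_pos_flip (nP i (le_m i)) Hq); exact: HPq.
  + apply: bezout_pos_mulX2; apply: bezout_pos_sum_l => i ik;
    apply: bezout_pos_sum_r => j jk.
    by apply: PP => //; lia.
  + apply: bezout_pos_add_l; first exact: bezout_pos_X.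
    rewrite XB; apply: bezout_pos_sum_l => i ik; apply: bezout_pos_sum_r =>
      j jk.
    by apply: flip => //; lia.
- apply: bezout_pos_add_r; first apply: bezout_pos_add_r; last 1 first.
  + by apply: bezout_pos_sum_l => i _; apply: HPq.
  + rewrite XA; apply: bezout_pos_sum_l => i ik; apply: bezout_pos_sum_r =>
    j jk.
    by apply: flip => //; lia.
  + apply: bezout_pos_add_r; first exact: bezout_pos_refl.
    apply: bezout_pos_sum_l => i ik; apply: bezout_pos_sum_r => j jk.
    by apply: PP => //; lia.
Qed.

Lemma nonneg_next_row k : nonneg_coefs (next_row k).
Proof.
have [nP _ _] := HP; have le_m (i : 'I_m.+1) : (i <= m)%N by rewrite -ltnS.
apply: nonneg_coefsD; last by case: Hq.
apply: nonneg_coefsD; first apply: nonneg_coefsXM.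
all: by apply: nonneg_coefs_sum => i _; case: (nP i (le_m i)).
Qed.

Lemma next_row_at1 k : 0 < (next_row k).[1].
Proof.
have [_ P1 _] := HP.
have -> : (next_row k).[1] = \sum_(i < m.+1) (P i).[1] + q.[1].
  rewrite /next_row !hornerD hornerM hornerX mul1r !horner_sum.
  by rewrite [in RHS](bigID (fun i : 'I__ => (i < k)%N)).
rewrite ltr_pwDl ?nonneg_horner_ge0 //; last by case: Hq.
rewrite big_ord_recl ltr_pwDl ?P1 // sumr_ge0 // => i _.
by rewrite ltW // P1 // lift0.
Qed.

Lemma bezout_pos_next_row0 : bezout_pos (P 0%N) (next_row 0).
Proof.
have [_ _ PP] := HP; rewrite next_row0; apply: bezout_pos_add_r;
  last exact: HPq.
by apply: bezout_pos_sum_r => i _; apply: PP => //; rewrite -ltnS.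
Qed.

Lemma horner_gt0_neq0 (p : {poly R}) x : 0 < p.[x] -> p != 0.
Proof. by apply: contraTneq => ->; rewrite horner0 ltxx. Qed.

Theorem interlacing_next_row : interlacing_sequence m.+1 next_row.
Proof.
have [nP P1 _] := HP.
have n0 : nonneg_rr (next_row 0).
  apply: (bezout_pos_nonneg_rr _ (nP 0%N _) bezout_pos_next_row0 (nonneg_next_row 0)) => //.
  exact: horner_gt0_neq0 (P1 0%N _).
split=> [i _|i _|i j ij _]; [|exact: next_row_at1|exact: bezout_pos_next_row].
apply: (bezout_pos_nonneg_rr _ n0 (bezout_pos_next_row (leq0n i))
  (nonneg_next_row i)).
exact: horner_gt0_neq0 (next_row_at1 0).
Qed.

End Step.

(** * The theorem *)

Section Main.
Variables (R : realType) (d : option nat) (f : nat -> nat -> nat) (n : nat).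
Hypothesis feas : feasible R d f.
Hypothesis n_le_d : le_size n d.
Local Notation h := (hpoly_simplex R f).
Local Notation p := (ppoly R f).

(** The h-polynomial of the uniform triangulation of the boundary of the
    simplex of rank m + 1. *)
Definition boundary_sum m : {poly R} := \sum_(k < m.+1) p m k.
Definition interior_part m : {poly R} := h m.+1 - boundary_sum m.

Lemma le_size_trans m : (m <= n)%N -> le_size m d.
Proof. by move: n_le_d; case: (d) => //= d' nd mn; apply: leq_trans mn nd. Qed.

Lemma size_boundary_sum m : (size (boundary_sum m) <= m.+1)%N.
Proof.
apply: (leq_trans (size_sum _ _ _)); apply/bigmax_leqP => k _.
by apply: size_ppoly; rewrite -ltnS.
Qed.

(** Reversing the relation rev h = h + (x - 1) S a second time gives
    (x - 1) (S - rev S) = 0, so S is palindromic, and then so is h - S. *)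
Lemma reversal_boundary_interior m : (m < n)%N ->
  reversal m (boundary_sum m) = boundary_sum m /\
  reversal m.+1 (interior_part m) = interior_part m.
Proof.
move=> mn; set S := boundary_sum m.
have sS : (size S <= m.+1)%N := size_boundary_sum m.
have hE : reversal m.+1 (h m.+1) = h m.+1 + ('X - 1) * S.
  rewrite (hpoly_simplex_dehn_sommerville feas (le_size_trans mn)) ppoly_boundary //.
have SE : reversal m S = S.
  have := reversalK (size_hpoly_simplex R f m.+1).
  rewrite {1}hE mulrBl mul1r !reversalD reversalN (reversal_XM sS)
    (reversal_lift sS) hE => E.
  apply/eqP; rewrite eq_sym -subr_eq0; have : ('X - 1) * (S - reversal m S) = 0.
    by rewrite -[RHS](subrr (h m.+1)) -[X in _ = X - _]E; ring.
  by move/eqP; rewrite mulf_eq0 -polyC1 polyXsubC_eq0.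
by split=> //;
  rewrite /interior_part reversalD reversalN -/S (reversal_lift sS) SE hE; ring.
Qed.

(** The polynomial has degree at most one, vanishes at 0 and is
    palindromic. *)
Lemma interior_part0 : (0 < n)%N -> interior_part 0 = 0.
Proof.
move=> n0; have [_ /polyP qr] := reversal_boundary_interior n0.
have q0 : (interior_part 0)`_0 = 0.
  rewrite /interior_part /boundary_sum big_ord1 ppolyn0 coefB.
  by rewrite !(hpoly_simplex0 feas) ?subrr // le_size_trans.
have sq : (size (interior_part 0) <= 2)%N.
  apply: (leq_trans (size_polyD _ _));
    rewrite geq_max size_opp size_hpoly_simplex.
  by rewrite (leq_trans (size_boundary_sum 0)).
apply/polyP => -[|[|i]]; rewrite coef0 //;
  last by rewrite nth_default // (leq_trans sq).
by rewrite -qr coef_poly.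
Qed.

Hypothesis H2 : forall m, (2 <= m <= n)%N ->
       let q := hpoly_simplex R f m - hpoly_uniform R f (simplex_boundary m) in
       q = 0 \/
       [/\ real_rooted q, size q = m, nonneg_coefs q &
           interlaces (hpoly_simplex R f m.-1) q].

(** If q is not zero, the hypothesis is the case i = 0.  Since q is
    palindromic and p_{m,m} is the reversal of p_{m,0}, reversing the certificate
    gives the case i = m.  The roots of the other p_{m,i} lie between those of
    these two. *)
Lemma interior_partP m : (m < n)%N -> interlacing_sequence m (p m) ->
  [/\ nonneg_rr (interior_part m), (size (interior_part m) <= m.+1)%N &
      forall i, (i <= m)%N -> bezout_pos (p m i) (interior_part m)].
Proof.
set q := interior_part m; move=> mn [nP P1 PP].
have zero_case : q = 0 ->
  [/\ nonneg_rr q, (size q <= m.+1)%N & forall i, (i <= m)%N ->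
  bezout_pos (p m i) q].
  by move=> ->; rewrite size_poly0; split=> // *;
    [exact: nonneg_rr0|exact: bezout_pos_0r].
have [m0|m_gt0] := posnP m.
  by apply: zero_case; rewrite /q m0 interior_part0 // (leq_trans _ mn).
have := H2 (m := m.+1);
  rewrite /= hpoly_uniform_boundary -/(boundary_sum m) -/(interior_part m) -/q.
case=> [|/zero_case //|[rq sq nq iq]]; first by rewrite ltnS m_gt0.
split=> //; first by rewrite sq.
have q0 : q != 0 by rewrite -size_poly_eq0 sq.
have z i : (i <= m)%N -> p m i != 0 by move=> /P1 /horner_gt0_neq0.
rewrite -(ppolyn0 R f m) in iq.
have nq' : nonneg_rr q by [].
have [us [su H]] :=
  interlaces_bezout_cert (nP _ (leq0n m)).2 nq (z _ (leq0n m)) q0 iq.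
have B0 : bezout_pos (p m 0%N) q by exists us.
have Bm : bezout_pos (p m m) q.
  apply/bezout_pos_flip => //; first exact: nP.
  have [_] := reversal_boundary_interior mn; rewrite -/q => qr.
  have DS := hpoly_simplex_dehn_sommerville feas (le_size_trans (ltnW mn)).
  exists (map (reversal m) us);
    rewrite -qr -DS -(ppolyn0 R f m) -reversal_lift ?size_ppoly //.
  apply: bezout_cert_reversal H.
  - by move=> u /su; rewrite sq /= => /leq_trans ->.
  - by rewrite (leq_trans (size_ppoly R f (leq0n m))).
  - by rewrite sq.
by move=> i im; apply: (@bezout_pos_between _ (p m 0%N) _ (p m m));
  rewrite ?z //;
  try apply: nP => //; apply: PP.
Qed.

(** Iterating the recurrence adds (x - 1) p_{m,i} for every i < k to
    p_{m+1,0}, which is the sum of all p_{m,i} plus the interior part. *)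
Lemma ppoly_next_row m k : (k <= m.+1)%N -> p m.+1 k = next_row m (p m)
  (interior_part m) k.
Proof.
move=> km; rewrite ppoly_boundary // /next_row (big_ord_widen _ (p m) km).
rewrite /interior_part /boundary_sum.
rewrite [X in h _ - X](bigID (fun i : 'I__ => (i < k)%N)) /=; ring.
Qed.

Lemma interlacing_ppoly m : (m <= n)%N -> interlacing_sequence m (p m).
Proof.
elim: m => [|m IHm] mn.
  have p00 : p 0 0 = 1.
    rewrite ppolyn0; apply/polyP => i; have := size_hpoly_simplex R f 0.
    case: i => [|i] sz;
      first by rewrite (hpoly_simplex0 feas) ?coef1 // le_size_trans.
    by rewrite nth_default ?coef1 // (leq_trans sz).
  split=> [i|i|i j ij]; rewrite leqn0 => /eqP i0; rewrite i0.
  - rewrite p00; split; last by move=> j; rewrite coef1 ler0n.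
    by right=> z; rewrite rmorph1 (negPf (root1 z)).
  - by rewrite p00 hornerC ltr01.
  - by move: ij; rewrite i0 leqn0 => /eqP ->; exact: bezout_pos_refl.
have IH := IHm (ltnW mn); have [nq _ Pq] := interior_partP mn IH.
have [H1 H3 H4] := interlacing_next_row IH nq Pq.
split=> [i im|i im|i j ij jm]; rewrite !ppoly_next_row ?(leq_trans ij) //;
  first exact: H1.
  exact: H3.
exact: H4.
Qed.

Lemma real_rooted_Dop (g : {poly R}) : nonneg_coefs g ->
  real_rooted (Dop f n g).
Proof.
move=> g0; have [nP P1 PP] := interlacing_ppoly (leqnn n).
apply: (@bezout_pos_real_rooted _ (p n 0%N)).
- exact: horner_gt0_neq0 (P1 0%N _).
- by have [] := nP 0%N (leq0n n).
apply: bezout_pos_sum_r => k _; apply: bezout_pos_scale_r => //.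
by apply: PP => //; rewrite -ltnS.
Qed.

Lemma boundary_interlaced m : (m < n)%N ->
  nonneg_rr (boundary_sum m) /\ bezout_pos (p m 0%N) (boundary_sum m).
Proof.
move=> mn; have [nP P1 PP] := interlacing_ppoly (ltnW mn).
have B : bezout_pos (p m 0%N) (boundary_sum m).
  by apply: bezout_pos_sum_r => k _; apply: PP => //; rewrite -ltnS.
split=> //; apply: bezout_pos_nonneg_rr B _;
  first exact: horner_gt0_neq0 (P1 0%N _).
  exact: nP.
by apply: nonneg_coefs_sum => k _; have [] := nP k; rewrite -1?ltnS.
Qed.

(** The symmetric part is the polynomial of the boundary, and x times the
    other one is the interior part.  All p_{m,i} interlace the interior part,
    hence so does their sum. *)
Lemma simplex_symdec m : n = m.+1 -> nonneg_rr_interlacing_symdec m (h n).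
Proof.
move=> nE; have mn : (m < n)%N by rewrite nE.
have IH := interlacing_ppoly (ltnW mn).
have [nq sq Pq] := interior_partP mn IH.
have [nS _] := boundary_interlaced mn.
have [Sr qr] := reversal_boundary_interior mn.
have /factor_theorem [b qE] : root (interior_part m) 0.
  rewrite /root horner_coef0 -qr coef_poly /= subn0 nth_default //.
rewrite subr0 mulrC in qE.
have sb : (size b <= m)%N.
  have [->|b0] := eqVneq b 0; first by rewrite size_poly0.
  by move: sq; rewrite qE mulrC size_mulX.
have nb : nonneg_rr b.
  have b0 : nonneg_coefs b.
    by move=> i; have := nq.2 i.+1; rewrite qE coefXM.
  split=> //; have [->|bN0] := eqVneq b 0; first by left.
  have [/eqP|rq] := nq.1; first by rewrite qE mulf_eq0 polyX_eq0 (negPf bN0).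
  by right=> z bz; apply: rq; rewrite qE rmorphM /= rootM bz orbT.
exists (boundary_sum m), b; split.
- split=> //.
  + by rewrite -qE nE /interior_part addrC subrK.
  + exact: size_boundary_sum.
  + move: qr; rewrite qE reversal_XM ?(leqW sb) //.
    case: m sb {mn nE IH nq sq Pq nS Sr qE} => [|m] sb; last first.
      have X0 : 'X != 0 :> {poly R} by rewrite polyX_eq0.
      by rewrite reversal_lift // => /(mulfI X0).
    by move: sb; rewrite leqn0 size_poly_eq0 => /eqP -> _; apply/polyP => i;
      rewrite coef_poly !coef0 if_same.
- by split; [case: nS|case: nb].
- by split; [case: nS|case: nb].
- apply: bezout_pos_interlaces => //; apply/bezout_pos_flip => //; rewrite -qE.
  by apply: bezout_pos_sum_l => k _; apply: Pq; rewrite -ltnS.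
Qed.

End Main.

Theorem theorem6p1 (R : realType) (d : option nat) (f : nat -> nat -> nat)
    (n : nat) (feasible_f : feasible R d f)
    (n_gt0 : (1 <= n)%N) (n_le_d : le_size n d)
    (H1 : forall m, (2 <= m < n)%N -> real_rooted (hpoly_simplex R f m))
    (H2 : forall m, (2 <= m <= n)%N ->
       let q := hpoly_simplex R f m - hpoly_uniform R f (simplex_boundary m) in
       q = 0 \/
       [/\ real_rooted q, size q = m, nonneg_coefs q &
           interlaces (hpoly_simplex R f m.-1) q]) :
  ((forall h : {poly R}, (size h <= n.+1)%N -> nonneg_coefs h ->
      real_rooted (Dop f n h)) /\
   (forall (V : finType) (Delta : {set {set V}}),
      simplicial_complex Delta -> rank_complex Delta = n ->
      nonneg_coefs (hpoly R Delta) ->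
      real_rooted (hpoly_uniform R f Delta))) /\
  ([/\ real_rooted (hpoly_simplex R f n),
       real_rooted (hpoly_uniform R f (simplex_boundary n)),
       interlaces (hpoly_simplex R f n.-1) (hpoly_simplex R f n) &
       interlaces (hpoly_simplex R f n.-1)
         (hpoly_uniform R f (simplex_boundary n))] /\
   nonneg_rr_interlacing_symdec n.-1 (hpoly_simplex R f n)).
Proof.
have D := real_rooted_Dop feasible_f n_le_d H2.
split; first split.
- by move=> g _; exact: D.
- move=> V Delta _ rk hD; rewrite /hpoly_uniform rk; exact: D.
case: n n_gt0 n_le_d H2 {H1 D} => // m _ md H2.
have mm := ltnSn m.
have IH := interlacing_ppoly feasible_f md H2 (leqnSn m).
have [nP _ _] := interlacing_ppoly feasible_f md H2 (leqnn m.+1).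
have [nP' _ _] := IH.
have [nq _ Pq] := interior_partP feasible_f md H2 mm IH.
have [nS BS] := boundary_interlaced feasible_f md H2 mm.
rewrite hpoly_uniform_boundary -/(boundary_sum R f m).
have n1 := nP 0%N (leq0n _); have n0 := nP' 0%N (leq0n _);
  rewrite !ppolyn0 in n1 n0 BS.
split; last exact: (simplex_symdec feasible_f md H2).
split.
- by case: n1.
- by case: nS.
- apply: bezout_pos_interlaces => //.
  rewrite -(ppolyn0 R f m) -(ppolyn0 R f m.+1) ppoly_next_row //.
  exact: bezout_pos_next_row0 IH Pq.
- exact: bezout_pos_interlaces.
Qed.
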